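(* For the generic $f \in \mathcal{C}(\{0,1\}^{\mathbb{N}})$, the induced map $\widetilde{f} : \mathcal{M}(\{0,1\}^{\mathbb{N}}) \to \mathcal{M}(\{0,1\}^{\mathbb{N}})$ has all of the following properties: (a) $\widetilde{f}$ has uncountably many periodic points of each period $p \geq 1$. (b) Any neighborhood of any periodic point of $\widetilde{f}$ of period $p$ contains uncountably many periodic points of $\widetilde{f}$ of period $kp$, for each $k \in \mathbb{N}$. (c) $R(\widetilde{f}) = \Omega(\widetilde{f}) = CR(\widetilde{f})$. (d) $CR(\widetilde{f})$ has empty interior in $\widetilde{f}(\mathcal{M}(\{0,1\}^{\mathbb{N}}))$ (with the subspace topology). (e) $P(\widetilde{f})$ is dense in $CR(\widetilde{f})$.
   Context: The Cantor space $\{0,1\}^{\mathbb{N}}$ ($\mathbb{N}=\{1,2,\dots\}$) carries the metric $d(\sigma,\sigma)=0$ and $d(\sigma,\tau)=1/n$, where $n$ is the least positive integer with $\sigma(n)\ne\tau(n)$. $\mathcal{C}(\{0,1\}^{\mathbb{N}})$ is the space of all continuous maps from $\{0,1\}^{\mathbb{N}}$ into itself with the metric $\tilde d(f,g)=\max_x d(f(x),g(x))$; it is a Baire space. ''The generic element of a Baire space $Z$ has property $P$'' means that the set of elements of $Z$ failing $P$ is of the first category (meager) in $Z$. For a compact metric space $(M,d)$, $\mathcal{M}(M)$ is the space of Borel probability measures on $M$ with the Prohorov metric $d_P(\mu,\nu)=\inf\{\delta>0:\mu(X)\le\nu(X^\delta)+\delta \text{ and } \nu(X)\le\mu(X^\delta)+\delta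 \text{ for all Borel } X\subset M\}$, where $X^\delta=\{x\in M: d(x,X)<\delta\}$; it is a compact metric space. For a continuous map $f:M\to M$, the induced map $\widetilde f:\mathcal{M}(M)\to\mathcal{M}(M)$ is $(\widetilde f(\mu))(X)=\mu(f^{-1}(X))$ for Borel $X$. For a continuous self-map $g$ of a compact metric space with metric $\rho$: $P(g)$, $R(g)$, $\Omega(g)$, $CR(g)$ denote the sets of periodic, recurrent, nonwandering and chain recurrent points of $g$. A point $x$ is periodic of period $p\ge1$ if $g^p(x)=x$ and $g^j(x)\ne x$ for $1\le j<p$; $x$ is recurrent if for every neighborhood $U$ of $x$ there is $n\ge1$ with $g^n(x)\in U$; $x$ is nonwandering if for every neighborhood $U$ of $x$ there is $n\ge1$ with $g^n(U)\cap U\ne\emptyset$; $x$ is chain recurrent if for every $\delta>0$ there are $k\ge1$ and points $x_0=x,x_1,\dots,x_k=x$ with $\rho(g(x_n),x_{n+1})<\delta$ for $0\le n<k$. *)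

(* Defs.v *)
From HB Require Import structures.
From mathcomp Require Import all_boot all_order all_algebra.
From mathcomp Require Import all_classical all_reals all_analysis.

Set Implicit Arguments.
Unset Strict Implicit.
Unset Printing Implicit Defensive.

Import Order.TTheory GRing.Theory Num.Def Num.Theory.
Import numFieldNormedType.Exports.

Local Open Scope classical_set_scope.
Local Open Scope ring_scope.

Definition nowhere_dense (T : topologicalType) (A : set T) : Prop :=
  (closure A)° = set0.

Definition first_category (T : topologicalType) (A : set T) : Prop :=
  exists2 F : (set T)^nat, (forall n, nowhere_dense (F n)) & A = \bigcup_n F n.

Definition generic (T : topologicalType) (P : T -> Prop) : Prop :=
  first_category [set z | ~ P z].

Section Dynamics.
Context {R : realType} {M : metricType R}.
Implicit Types (g : M -> M) (x : M).

Definition periodic_point g (p : nat) : set M :=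
  [set x | [/\ (1 <= p)%N, iter p g x = x &
     forall j, (1 <= j < p)%N -> iter j g x <> x]].

Definition periodic_points g : set M :=
  [set x | exists p, periodic_point g p x].

Definition recurrent g : set M :=
  [set x | forall U, nbhs x U -> exists2 n, (1 <= n)%N & U (iter n g x)].

Definition nonwandering g : set M :=
  [set x | forall U, nbhs x U ->
     exists2 n, (1 <= n)%N & (iter n g @` U) `&` U !=set0].

Definition chain_recurrent g : set M :=
  [set x | forall delta : R, 0 < delta ->
     exists k (c : nat -> M), [/\ (1 <= k)%N, c 0%N = x, c k = x &
       forall n, (n < k)%N -> mdist (g (c n)) (c n.+1) < delta]].

(* [ereal_inf], unlike [inf], gives the empty set an empty thickening *)
Definition thickening (X : set M) (delta : R) : set M :=
  [set x | (ereal_inf [set (mdist x y)%:E | y in X] < delta%:E)%E].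

Lemma thickeningE (X : set M) (delta : R) :
  thickening X delta = \bigcup_(y in X) ball y delta.
Proof.
apply/seteqP; split => x /=.
  move=> /ereal_inf_lt[_ [y Xy <-]]; rewrite lte_fin => xy.
  by exists y => //; rewrite ballEmdist/= metric_sym.
move=> [y Xy]; rewrite ballEmdist/= => yx.
apply: (@le_lt_trans _ _ (mdist x y)%:E); first exact/ereal_inf_lbound/imageP.
by rewrite lte_fin metric_sym.
Qed.

Lemma thickening_open (X : set M) (delta : R) : open (thickening X delta).
Proof.
rewrite thickeningE; apply: bigcup_open => y _.
rewrite openE => x; rewrite ballEmdist/= => yx.
rewrite /interior -nbhs_ballE; exists (delta - mdist y x).
  by rewrite /= subr_gt0.
move=> z; rewrite !ballEmdist/= ltrBrDl.
exact/le_lt_trans/metric_triangle.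
Qed.

Lemma thickening_comp (X : set M) (a b : R) :
  thickening (thickening X a) b `<=` thickening X (a + b).
Proof.
rewrite !thickeningE => x [y [z Xz zy] yx]; exists z => //.
exact: ball_triangle zy yx.
Qed.

Lemma thickening_le (X : set M) (a b : R) : a <= b ->
  thickening X a `<=` thickening X b.
Proof.
by move=> ab x; rewrite /thickening/= => /lt_le_trans; apply; rewrite lee_fin.
Qed.

End Dynamics.

Section CantorDist.
Context {R : realType}.
Implicit Types s t u : cantor_space.

(* coordinates are indexed from 0, whence the successor *)
Definition cantor_dist s t : R :=
  if pselect (exists n, s n != t n) is left e then (ex_minn e).+1%:R^-1 else 0.

Lemma cantor_dist_leP s t n :
  (cantor_dist s t <= n.+1%:R^-1) <-> (forall i, (i < n)%N -> s i = t i).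
Proof.
rewrite /cantor_dist; case: pselect => [e|e].
  case: ex_minnP => m stm mmin; rewrite lef_pV2 ?posrE// ler_nat ltnS.
  split=> [nm i ni|H].
    by apply/eqP/negPn/negP => /mmin; rewrite leqNgt (leq_trans ni nm).
  by rewrite leqNgt; apply/negP => /H /eqP; rewrite (negbTE stm).
split=> [_ i _|_]; last by rewrite invr_ge0.
by apply/eqP/negPn/negP => sti; apply: e; exists i.
Qed.

Lemma cantor_dist_ge0 s t : 0 <= cantor_dist s t.
Proof. by rewrite /cantor_dist; case: pselect => // e; rewrite invr_ge0. Qed.

Lemma cantor_dist_le1 s t : cantor_dist s t <= 1.
Proof. by rewrite -[1]invr1; apply/(cantor_dist_leP _ _ 0). Qed.

Lemma cantor_dist_ltP s t n i :
  cantor_dist s t < n.+1%:R^-1 -> (i <= n)%N -> s i = t i.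
Proof.
rewrite /cantor_dist; case: pselect => [e|e].
  case: ex_minnP => m stm mmin; rewrite ltf_pV2 ?posrE// ltr_nat ltnS => nm ni.
  by apply/eqP/negPn/negP => /mmin; rewrite leqNgt (leq_ltn_trans ni nm).
by move=> _ _; apply/eqP/negPn/negP => sti; apply: e; exists i.
Qed.

Lemma cantor_distP s t : s = t \/ exists n, cantor_dist s t = n.+1%:R^-1.
Proof.
rewrite /cantor_dist; case: pselect => [e|e]; first by right; eexists.
by left; apply/funext => i; apply/eqP/negPn/negP => sti; apply: e; exists i.
Qed.

Lemma cantor_distxx s : cantor_dist s s = 0.
Proof.
by rewrite /cantor_dist; case: pselect => // e; exfalso; case: e => n /eqP.
Qed.

Lemma cantor_dist_positivity s t : cantor_dist s t = 0 -> s = t.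
Proof.
by case: (cantor_distP s t) => // -[n ->] /eqP; rewrite invr_eq0 pnatr_eq0.
Qed.

Lemma cantor_dist_sym s t : cantor_dist s t = cantor_dist t s.
Proof.
suff H a b : cantor_dist a b <= cantor_dist b a by apply/eqP; rewrite eq_le !H.
case: (cantor_distP b a) => [->|[n ban]]; first by rewrite cantor_distxx.
rewrite ban; apply/cantor_dist_leP => i ni; apply/esym.
by move: i ni; apply/cantor_dist_leP; rewrite ban.
Qed.

Lemma cantor_dist_ultra s t u :
  cantor_dist s u <= Num.max (cantor_dist s t) (cantor_dist t u).
Proof.
wlog H : s u / cantor_dist s t <= cantor_dist t u.
  move=> W; have [h|/ltW h] := leP (cantor_dist s t) (cantor_dist t u).
    by rewrite -(max_r h); exact: W.
  rewrite cantor_dist_sym -(max_l h) maxC (cantor_dist_sym t u).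
  rewrite (cantor_dist_sym s t); apply: W.
  by rewrite cantor_dist_sym (cantor_dist_sym t s).
rewrite max_r//; case: (cantor_distP t u) => [tu|[n tun]].
  by move: H; rewrite tu.
rewrite tun; apply/cantor_dist_leP => i ni.
have -> : s i = t i.
  by move: i ni; apply/cantor_dist_leP; rewrite -tun.
by move: i ni; apply/cantor_dist_leP; rewrite tun.
Qed.

Lemma cantor_dist_triangle t s u :
  cantor_dist s u <= cantor_dist s t + cantor_dist t u.
Proof.
rewrite (le_trans (cantor_dist_ultra s t u))// ge_max.
by rewrite lerDl lerDr !cantor_dist_ge0.
Qed.

End CantorDist.

Section CantorMetric.
Context {R : realType}.

Let cball (s : cantor_space) (e : R) : set cantor_space :=
  [set t | cantor_dist s t < e].

Let cball_center s (e : R) : 0 < e -> cball s e s.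
Proof. by move=> e0; rewrite /cball/= cantor_distxx. Qed.

Let cball_sym s t (e : R) : cball s e t -> cball t e s.
Proof. by rewrite /cball/= cantor_dist_sym. Qed.

Let cball_triangle s t u (e1 e2 : R) :
  cball s e1 t -> cball t e2 u -> cball s (e1 + e2) u.
Proof.
move=> st tu; apply: le_lt_trans (cantor_dist_triangle t s u) _.
exact: ltrD.
Qed.

Let coord_entourage (n : nat) :
  entourage [set st : cantor_space * cantor_space | st.1 n = st.2 n].
Proof.
set E := [set _ | _].
have entE : `[< @entourage (initial_topology (@proj nat (fun=> bool) n)) E >].
  apply/asboolP; exists [set bc : bool * bool | bc.1 = bc.2]; last by [].
  by rewrite uniform_discrete => _ [b _ <-].
exists E => //.
match goal with |- finI_from ?D ?f _ =>
  exact: (@finI_from1 _ _ D f (exist _ (n, E) entE) I)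
end.
Qed.

Let cball_entourage :
  @entourage cantor_space = entourage_ cball.
Proof.
apply/seteqP; split => [P|P].
  have FF : Filter (entourage_ cball).
    apply: filter_from_filter; first by exists 1 => /=.
    move=> a b /= a0 b0; exists (Num.min a b); first by rewrite /= lt_min a0.
    by move=> [s t]; rewrite /cball/= lt_min => /andP[].
  case => _ [F _ <-] FP; apply: (filterS FP).
  apply: filter_bigI => -[[n B] /= +] _.
  move=> /asboolP[V entV VB]; exists n.+1%:R^-1; first by rewrite /= invr_gt0.
  move=> [s t]; rewrite /cball/= => st; apply: VB => /=.
  have snt : s n = t n := cantor_dist_ltP st (leqnn n).
  by have : V (s n, t n) by rewrite snt; exact: entourage_refl.
move=> [e /= e0 eP].
pose n := truncn e^-1.
have ne : n.+1%:R^-1 < e.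
  by rewrite invf_plt ?posrE// truncnS_gt.
have entn k : entourage [set st : cantor_space * cantor_space |
    forall i, (i < k)%N -> st.1 i = st.2 i].
  elim: k => [|k IHk]; first exact: filterS filterT.
  apply: filterS (filterI IHk (coord_entourage k)) => -[s t] /= [stk stkk] i.
  by rewrite ltnS leq_eqVlt => /predU1P[->|/stk].
apply: filterS (entn n) => -[s t] /= stn; apply: eP; rewrite /cball/=.
by apply: le_lt_trans ne; apply/cantor_dist_leP.
Qed.

HB.instance Definition _ := Uniform_isPseudoMetric.Build R cantor_space
  cball_center cball_sym cball_triangle cball_entourage.

Let ball_cantorE (s : cantor_space) (e : R) :
  ball s e = [set t | cantor_dist s t < e].
Proof. by []. Qed.

HB.instance Definition _ := PseudoMetric_isMetric.Build R cantor_space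
  (@cantor_dist_ge0 R) (@cantor_dist_positivity R) ball_cantorE.

End CantorMetric.


(* the phantom parameter R lets the topology of uniform convergence, which is
   induced by an R-valued metric, be inferred from the type *)
Definition cantor_map (R : realType) : Type :=
  continuousType cantor_space cantor_space.

HB.instance Definition _ (R : realType) := Choice.on (cantor_map R).

Section CantorMap.
Context {R : realType}.
Implicit Types f g h : cantor_map R.

Definition cantor_map_fun f : cantor_space -> cantor_space :=
  @Continuous.sort cantor_space cantor_space f.

Coercion cantor_map_fun : cantor_map >-> Funclass.

Definition cantor_map_dist f g : R :=
  sup [set mdist (f x) (g x) | x in [set: cantor_space]].

Lemma cantor_map_dist_max f g :
  (exists x, cantor_map_dist f g = mdist (f x) (g x)) /\
  (forall x, mdist (f x) (g x) <= cantor_map_dist f g).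
Proof.
have ubd : has_sup [set (mdist (f x) (g x) : R) | x in [set: cantor_space]].
  split; first by exists (mdist (f point) (g point)); exists point.
  by exists 1 => _ [x _ <-]; exact: cantor_dist_le1.
have le_dist x : mdist (f x) (g x) <= cantor_map_dist f g.
  by apply: sup_upper_bound => //; exists x.
split=> //.
have [fg|/existsNP[x0 fgx0]] := pselect (forall x, f x = g x).
  exists point; apply/eqP; rewrite eq_le le_dist andbT.
  apply: ge_sup; first by case: ubd.
  by move=> _ [x _ <-]; rewrite !fg !mdistxx.
have ex : exists n, `[< exists x, mdist (f x) (g x) = n.+1%:R^-1 :> R >].
  case: (@cantor_distP R (f x0) (g x0)) => // -[n fgn].
  by exists n; apply/asboolP; exists x0.
case: (ex_minnP ex) => m /asboolP[x fgx] mmin; exists x.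
apply/eqP; rewrite eq_le le_dist andbT; apply: ge_sup; first by case: ubd.
move=> _ [y _ <-]; case: (@cantor_distP R (f y) (g y)) => [->|[n fgn]].
  by rewrite mdistxx mdist_ge0.
rewrite fgx (fgn : mdist _ _ = _) lef_pV2 ?posrE// ler_nat ltnS mmin//.
by apply/asboolP; exists y.
Qed.

Let dist_le f g (c : R) : (forall x, mdist (f x) (g x) <= c) ->
  cantor_map_dist f g <= c.
Proof. by have [[x ->] _] := cantor_map_dist_max f g. Qed.

Let le_dist f g x : mdist (f x) (g x) <= cantor_map_dist f g.
Proof. by have [_] := cantor_map_dist_max f g. Qed.

Let distxx f : cantor_map_dist f f = 0.
Proof. by have [[x ->] _] := cantor_map_dist_max f f; rewrite mdistxx. Qed.

Let dist_positivity f g : cantor_map_dist f g = 0 -> f = g.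
Proof.
move=> fg0; apply/continuousEP => x; apply: (@mdist_positivity R).
by apply/eqP; rewrite eq_le mdist_ge0 andbT -fg0; exact: le_dist.
Qed.

Let dist_sym f g : cantor_map_dist f g = cantor_map_dist g f.
Proof.
by apply/eqP; rewrite eq_le; apply/andP; split; apply: dist_le => x;
  rewrite metric_sym; exact: le_dist.
Qed.

Let dist_triangle g f h :
  cantor_map_dist f h <= cantor_map_dist f g + cantor_map_dist g h.
Proof.
apply: dist_le => x; apply: (le_trans (metric_triangle _ (g x) _)).
by apply: lerD; exact: le_dist.
Qed.

HB.instance Definition _ := isMetric.Build R (cantor_map R)
  distxx dist_positivity dist_sym dist_triangle.

End CantorMap.

Notation borel_cantor := (g_sigma_algebraType (@open cantor_space)).

(* [probability] leaves the values on nonmeasurable sets unconstrained; they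
   are fixed to 0 so that equality is equality of Borel measures *)
Record cantor_measure (R : realType) := CantorMeasure {
  cantor_measure_prob :> probability borel_cantor R ;
  _ : forall X : set borel_cantor,
    ~ measurable X -> cantor_measure_prob X = 0%E
}.

HB.instance Definition _ (R : realType) := gen_eqMixin (cantor_measure R).
HB.instance Definition _ (R : realType) := gen_choiceMixin (cantor_measure R).

Section CantorMeasure.
Context {R : realType}.
Implicit Types mu nu la : cantor_measure R.

Lemma cantor_measure_eq mu nu :
  (forall X : set borel_cantor, measurable X -> mu X = nu X) -> mu = nu.
Proof.
case: mu nu => [P P0] [Q Q0] /= PQ.
have {}PQ : P = Q.
  have PQE : (P : set borel_cantor -> \bar R) = Q.
    apply/funext => X; have [/PQ//|mX] := pselect (measurable X).
    by rewrite P0// Q0.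
  move: P Q PQE {P0 Q0 PQ} => [P cP] [Q cQ] /= PQE.
  subst Q; congr Probability.Pack.
  case: cP cQ => [[c1 c2] [c3] [c4] [c5] [c6] [c7] [c8]].
  case=> [[d1 d2] [d3] [d4] [d5] [d6] [d7] [d8]].
  by rewrite (Prop_irrelevance c1 d1) (Prop_irrelevance c2 d2)
    (Prop_irrelevance c3 d3) (Prop_irrelevance c4 d4) (Prop_irrelevance c5 d5)
    (Prop_irrelevance c6 d6) (Prop_irrelevance c7 d7) (Prop_irrelevance c8 d8).
by subst Q; congr CantorMeasure; exact: Prop_irrelevance.
Qed.

Lemma measurable_thickening (X : set cantor_space) (delta : R) :
  measurable (thickening X delta : set borel_cantor).
Proof. by apply: sub_sigma_algebra; exact: thickening_open. Qed.

Definition prohorov_set mu nu : set R :=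
  [set delta | 0 < delta /\ forall X : set borel_cantor, measurable X ->
     (mu X <= nu (thickening (X : set cantor_space) delta) + delta%:E)%E /\
     (nu X <= mu (thickening (X : set cantor_space) delta) + delta%:E)%E].

Definition prohorov mu nu : R := inf (prohorov_set mu nu).

Let has_inf_prohorov mu nu : has_inf (prohorov_set mu nu).
Proof.
split; last by exists 0 => d [/ltW].
exists 1; split=> // X mX.
by split; apply: (le_trans (probability_le1 _ mX)); apply: leeDr;
  exact: measure_ge0.
Qed.

Let prohorov_set_le mu nu (a b : R) : a <= b ->
  prohorov_set mu nu a -> prohorov_set mu nu b.
Proof.
move=> ab [a0 H]; split; first exact: lt_le_trans ab.
move=> X mX; have [H1 H2] := H X mX; split.
- apply: (le_trans H1); apply: leeD; last by rewrite lee_fin.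
  by apply: le_measure; rewrite ?inE;
    [exact: measurable_thickening..|exact: thickening_le].
- apply: (le_trans H2); apply: leeD; last by rewrite lee_fin.
  by apply: le_measure; rewrite ?inE;
    [exact: measurable_thickening..|exact: thickening_le].
Qed.

Lemma prohorov_ltP mu nu (delta : R) :
  prohorov mu nu < delta -> prohorov_set mu nu delta.
Proof.
rewrite -subr_gt0 => /inf_adherent /(_ (has_inf_prohorov mu nu))[e He].
by rewrite -/(prohorov _ _) subrKC => /ltW ed; exact: prohorov_set_le He.
Qed.

Let prohorov_le mu nu (delta : R) :
  prohorov_set mu nu delta -> prohorov mu nu <= delta.
Proof. by move=> H; apply: ge_inf => //; have [] := has_inf_prohorov mu nu. Qed.

Let prohorov_ge0 mu nu : 0 <= prohorov mu nu.
Proof.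
by apply: lb_le_inf; [have [] := has_inf_prohorov mu nu|move=> d [/ltW]].
Qed.

Let sub_thickening (X : set cantor_space) (delta : R) : 0 < delta ->
  X `<=` thickening X delta.
Proof.
by move=> d0 x Xx; rewrite thickeningE; exists x => //; exact: ballxx.
Qed.

Let prohorovxx mu : prohorov mu mu = 0.
Proof.
apply/eqP; rewrite eq_le prohorov_ge0 andbT; apply/ler_addgt0Pl => e e0.
rewrite addr0; apply: prohorov_le; split=> // X mX.
suff : (mu X <= mu (thickening (X : set cantor_space) e) + e%:E)%E by [].
rewrite -[leLHS]adde0; apply: leeD; last by rewrite lee_fin ltW.
by apply: le_measure; rewrite ?inE//;
  [exact: measurable_thickening|exact: sub_thickening].
Qed.

Let prohorov_sym mu nu : prohorov mu nu = prohorov nu mu.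
Proof.
by congr inf; apply/seteqP; split => d [d0 H]; split=> // X /H[].
Qed.

Let prohorov_triangle la mu nu :
  prohorov mu nu <= prohorov mu la + prohorov la nu.
Proof.
apply/ler_addgt0Pl => e e0.
have e20 : 0 < e / 2 by rewrite divr_gt0.
pose a := prohorov mu la + e / 2; pose b := prohorov la nu + e / 2.
have [a0 Ha] : prohorov_set mu la a by apply: prohorov_ltP; rewrite ltrDl.
have [b0 Hb] : prohorov_set la nu b by apply: prohorov_ltP; rewrite ltrDl.
have -> : e + (prohorov mu la + prohorov la nu) = a + b.
  by rewrite /a /b addrACA -splitr addrC.
apply: prohorov_le; split; first exact: addr_gt0.
move=> X mX; have [Ha1 _] := Ha _ mX; have [_ Hb2] := Hb _ mX.
have [Hb1 _] := Hb _ (measurable_thickening X a).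
have [_ Ha2] := Ha _ (measurable_thickening X b).
split.
- apply: (le_trans Ha1).
  rewrite (_ : (a + b)%:E = (b%:E + a%:E)%E); last by rewrite addeC -EFinD.
  rewrite addeA; apply: leeD => //; apply: (le_trans Hb1); apply: leeD => //.
  apply: le_measure; rewrite ?inE; [exact: measurable_thickening..|].
  exact: thickening_comp.
- apply: (le_trans Hb2); rewrite (EFinD a b) addeA; apply: leeD => //.
  apply: (le_trans Ha2); apply: leeD => //.
  apply: le_measure; rewrite ?inE; [exact: measurable_thickening..|].
  by rewrite addrC; exact: thickening_comp.
Qed.

Let thickening_bigcap (X : set cantor_space) : closed X ->
  \bigcap_n thickening X (n.+1%:R^-1 : R) = X.
Proof.
move=> cX; apply/seteqP; split => [x Hx|x Xx n _]; last exact: sub_thickening.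
apply: cX => U /(@nbhs_ballP R cantor_space)[e /= e0 eU].
pose n := truncn e^-1.
have ne : n.+1%:R^-1 < e by rewrite invf_plt ?posrE// truncnS_gt.
have := Hx n I; rewrite thickeningE => -[y Xy yx]; exists y; split=> //.
by apply: eU; apply: ball_sym; apply: le_ball yx; exact: ltW.
Qed.

Let prohorov_closed_le mu nu (X : set borel_cantor) :
  prohorov mu nu = 0 -> closed (X : set cantor_space) -> (mu X <= nu X)%E.
Proof.
move=> d0 cX.
have mX : measurable X.
  rewrite -[X]setCK; apply: measurableC; apply: sub_sigma_algebra.
  exact: closed_openC.
pose F n : set borel_cantor :=
  thickening (X : set cantor_space) (n.+1%:R^-1 : R).
have mF n : measurable (F n) by exact: measurable_thickening.
have cvF : nu (F n) @[n --> \oo] --> nu X.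
  rewrite -(thickening_bigcap cX); apply: nonincreasing_cvg_mu => //.
  - by rewrite (le_lt_trans (probability_le1 _ (mF _)))// ltry.
  - exact: bigcapT_measurable.
  - move=> m n mn; apply/subsetPset/thickening_le.
    by rewrite lef_pV2 ?posrE// ler_nat.
have cv0 : (n.+1%:R^-1 : R)%:E @[n --> \oo] --> 0%E.
  by apply/cvg_EFin; [exact: nearW|exact: cvg_harmonic].
have cv : (nu (F n) + (n.+1%:R^-1 : R)%:E)%E @[n --> \oo] --> nu X.
  rewrite -[X in _ --> X]adde0; apply: cvgeD => //.
  by rewrite fin_num_adde_defl.
rewrite -(cvg_lim _ cv)//; apply: lime_ge.
  by apply/cvg_ex; eexists; exact: cv.
apply: nearW => n; have : prohorov_set mu nu n.+1%:R^-1.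
  by apply: prohorov_ltP; rewrite d0 invr_gt0.
by move=> [_ /(_ X mX)[]].
Qed.

Let prohorov_positivity mu nu : prohorov mu nu = 0 -> mu = nu.
Proof.
move=> d0; apply: cantor_measure_eq => X mX.
have eq_closed (Y : set borel_cantor) : closed (Y : set cantor_space) ->
    mu Y = nu Y.
  move=> cY; apply/eqP; rewrite eq_le prohorov_closed_le//.
  by rewrite prohorov_closed_le// prohorov_sym.
pose G := @closed cantor_space : set (set borel_cantor).
have GS : <<s G >> = measurable :> set (set borel_cantor).
  apply/seteqP; split.
    apply: smallest_sub; first exact: sigma_algebra_measurable.
    move=> Y cY; rewrite -[Y]setCK.
    apply: measurableC; apply: sub_sigma_algebra; exact: closed_openC.
  apply: smallest_sub; first exact: smallest_sigma_algebra.
  move=> Y oY; rewrite -[Y]setCK; apply: sigma_algebraC.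
  apply: sub_sigma_algebra; exact: open_closedC.
pose H := [set Y | G Y /\ Y `<=` [set: borel_cantor]].
have HG : H = G by apply/seteqP; split => [Y []|Y].
apply: (g_sigma_algebra_measure_unique_trace G setT) => //.
- move=> Y [cY _]; rewrite -GS; exact: sub_sigma_algebra.
- by rewrite -/H HG => A B; exact: closedI.
- exact: etrans (probability_setT mu) (esym (probability_setT nu)).
- by move=> Y [cY _]; exact: eq_closed.
- by rewrite (le_lt_trans (probability_le1 mu measurableT))// ltry.
- by rewrite -/H HG GS.
Qed.

HB.instance Definition _ := isMetric.Build R (cantor_measure R)
  prohorovxx prohorov_positivity prohorov_sym prohorov_triangle.

End CantorMeasure.

Section BorelRestriction.
Context {R : realType} (P : probability borel_cantor R).
Local Open Scope ereal_scope.

Definition borel_restriction (X : set borel_cantor) : \bar R :=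
  if pselect (measurable X) then P X else 0.

Let borel_restrictionE X : measurable X -> borel_restriction X = P X.
Proof. by rewrite /borel_restriction; case: pselect. Qed.

Let borel_restriction0 : borel_restriction set0 = 0.
Proof. by rewrite (borel_restrictionE measurable0) measure0. Qed.

Let borel_restriction_ge0 X : 0 <= borel_restriction X.
Proof.
by rewrite /borel_restriction; case: pselect => // mX; exact: measure_ge0.
Qed.

Let borel_restriction_sigma_additive : semi_sigma_additive borel_restriction.
Proof.
move=> F mF tF mUF; rewrite borel_restrictionE//.
under eq_fun do under eq_bigr do rewrite borel_restrictionE//.
exact: measure_semi_sigma_additive.
Qed.

HB.instance Definition _ := isMeasure.Build _ _ _ borel_restriction
  borel_restriction0 borel_restriction_ge0 borel_restriction_sigma_additive.

Let borel_restrictionT : borel_restriction [set: borel_cantor] = 1.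
Proof. by rewrite (borel_restrictionE measurableT) probability_setT. Qed.

HB.instance Definition _ := Measure_isProbability.Build _ _ _
  borel_restriction borel_restrictionT.

Definition cantor_measure_of : cantor_measure R.
Proof.
exists borel_restriction => X mX /=.
by rewrite /borel_restriction; case: pselect.
Defined.

End BorelRestriction.

Section Induced.
Context {R : realType} (f : cantor_map R).

Definition borel_map : borel_cantor -> borel_cantor := f.

Let measurable_borel_map : measurable_fun [set: borel_cantor] borel_map.
Proof.
apply: (@measurability _ _ _ _ setT borel_map (@open cantor_space)) => //.
move=> _ [U oU <-]; rewrite setTI; apply: sub_sigma_algebra.
by apply: open_comp => // x _; exact: (@cts_fun _ _ f).
Qed.

HB.instance Definition _ := isMeasurableFun.Build _ _ _ _ borel_map
  measurable_borel_map.

Definition induced_map (mu : cantor_measure R) : cantor_measure R :=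
  cantor_measure_of (distribution mu borel_map).

Lemma induced_mapE (mu : cantor_measure R) (X : set borel_cantor) :
  measurable X -> induced_map mu X = mu (f @^-1` X).
Proof. by rewrite /induced_map /= /borel_restriction; case: pselect. Qed.

End Induced.

(* Main.v *)
From HB Require Import structures.
Require Import Defs.
From mathcomp Require Import all_boot all_order all_algebra.
From mathcomp Require Import all_classical all_reals all_analysis.
From mathcomp Require Import zify ring lra.

Set Implicit Arguments.
Unset Strict Implicit.
Unset Printing Implicit Defensive.

Import Order.TTheory GRing.Theory Num.Def Num.Theory.
Import numFieldNormedType.Exports.

Local Open Scope classical_set_scope.
Local Open Scope ring_scope.

                                                                             
                                                                         
                                                                             
                                                                                
                                                                                
                                                                                
                                                                                
                                                                          
                                                                               
                                                                                
                                                                                  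

(** Call f a level map at m if the first m coordinates of x determine those of f x; then f acts on
    the finite set of words of length m, and every orbit of words ends in a cycle. The property
    [rich f n] asks for a level m >= n with this feature, for a point of the image whose word is not
    on a cycle, and for two orbits that never share a word and whose words reveal time modulo n+1.
    Richness depends on finitely many coordinates of the values of f, so it is stable under small
    perturbations ([rich_perturb]). It is also dense: behind the first coordinates of f one installs
    a small finite machine ([rich_dense]). Hence the generic f is rich for every n ([generic_rich]),
    and the rest concerns such an f.

    Prohorov closeness amounts to closeness of masses of sets determined by finitely many
    coordinates, so the induced map F is studied through the finite word dynamics. A chain recurrent
    measure gives no mass to words off the cycles ([chain_recurrent_supported]). Conversely a
    measure with this property returns at each level after a factorial number of steps
    ([supported_recurrent]), and it is approximated by averages of periodic measures placed on the
    cyclic words ([supported_closure]). This gives (c) and (e).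

    For (a) and (b), averaging along a word orbit that reveals time modulo p gives a measure of
    exact period p ([invariant_measure], [periodic_point_neq]). Since F is affine, mixing a given
    periodic measure with such a measure, with small weight s, gives the prescribed period for all
    but finitely many s ([periodic_uncountable]). For (d), mixing in a small amount of a measure
    whose image charges a noncyclic word destroys chain recurrence
    ([nbhs_range_not_chain_recurrent]). *)

(** * Cylinders and clopen sets of the Cantor space *)

Definition agree (m : nat) (x y : cantor_space) : Prop :=
  forall i, (i < m)%N -> x i = y i.

Lemma agree_refl m x : agree m x x. Proof. by []. Qed.

Lemma agree_sym m x y : agree m x y -> agree m y x.
Proof. by move=> xy i im; rewrite xy. Qed.

Lemma agree_trans m y x z : agree m x y -> agree m y z -> agree m x z.
Proof. by move=> xy yz i im; rewrite xy// yz. Qed.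

Lemma agreeW m n x y : (m <= n)%N -> agree n x y -> agree m x y.
Proof. by move=> mn xy i im; apply: xy; exact: leq_trans mn. Qed.

Definition determined (m : nat) (A : set cantor_space) : Prop :=
  forall x y, agree m x y -> A x -> A y.

Lemma determinedC m A : determined m A -> determined m (~` A).
Proof.
by move=> dA x y xy nAx Ay; apply: nAx; apply: dA Ay; exact: agree_sym.
Qed.

Lemma determinedI m A B :
  determined m A -> determined m B -> determined m (A `&` B).
Proof. by move=> dA dB x y xy [/(dA _ _ xy) ? /(dB _ _ xy) ?]. Qed.

Lemma determinedU m A B :
  determined m A -> determined m B -> determined m (A `|` B).
Proof. by move=> dA dB x y xy [/(dA _ _ xy) ?|/(dB _ _ xy) ?]; [left|right]. Qed.

Lemma determinedW m n A : (m <= n)%N -> determined m A -> determined n A.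
Proof. by move=> mn dA x y /(agreeW mn); exact: dA. Qed.

Lemma determined_agree m x : determined m [set y | agree m x y].
Proof. by move=> y z yz xy; apply: agree_trans yz. Qed.

Lemma mdist_agreeP (R : realType) m (x y : cantor_space) :
  (mdist x y <= m.+1%:R^-1 :> R) <-> agree m x y.
Proof. exact: cantor_dist_leP. Qed.

Lemma invS_lt_ex (R : realType) (e : R) :
  0 < e -> exists n, forall m, (n <= m)%N -> m.+1%:R^-1 < e.
Proof.
move=> e0; exists (truncn e^-1) => m nm.
rewrite invf_plt ?posrE//; apply: lt_le_trans (truncnS_gt _) _.
by rewrite ler_nat.
Qed.

Lemma nbhs_agreeP (R : realType) (x : cantor_space) (U : set cantor_space) :
  nbhs x U <-> exists m, forall y, agree m x y -> U y.
Proof.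
split=> [/(@nbhs_ballP R cantor_space)[e /= e0 eU]|[m mU]].
  have [n ne] := invS_lt_ex e0; exists n => y xy; apply: eU.
  rewrite ballEmdist/=; apply: le_lt_trans (ne _ (leqnn n)).
  exact/mdist_agreeP.
apply/(@nbhs_ballP R cantor_space); exists m.+1%:R^-1 => /=.
  by rewrite invr_gt0.
by move=> y; rewrite ballEmdist/= => /ltW /mdist_agreeP; exact: mU.
Qed.

Lemma determined_open (R : realType) m A : determined m A -> open A.
Proof.
move=> dA; rewrite openE => x Ax; apply/(nbhs_agreeP R).
by exists m => y /dA; apply.
Qed.

Lemma determined_measurable (R : realType) m (A : set borel_cantor) :
  determined m A -> measurable A.
Proof. by move=> dA; apply: sub_sigma_algebra; exact: (determined_open R dA). Qed.

Lemma determined_compact (R : realType) m A : determined m A -> compact A.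
Proof.
move=> dA; apply: (subclosed_compact _ cantor_space_compact) => //.
rewrite -[A]setCK; apply: open_closedC.
exact: (determined_open R (determinedC dA)).
Qed.

Definition clopen_set (A : set cantor_space) : Prop :=
  exists m, determined m A.

Lemma clopen_setC A : clopen_set A -> clopen_set (~` A).
Proof. by move=> [m dA]; exists m; exact: determinedC. Qed.

Lemma clopen_setU A B : clopen_set A -> clopen_set B -> clopen_set (A `|` B).
Proof.
move=> [m dA] [n dB]; exists (maxn m n).
by apply: determinedU; [apply: determinedW dA|apply: determinedW dB];
  rewrite ?leq_maxl ?leq_maxr.
Qed.

Lemma clopen_setT : clopen_set setT. Proof. by exists 0%N. Qed.

Lemma clopen_set0 : clopen_set set0. Proof. by exists 0%N. Qed.

Lemma clopen_bigU (F : nat -> set cantor_space) n :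
  (forall i, clopen_set (F i)) -> clopen_set (\big[setU/set0]_(i < n) F i).
Proof.
move=> cF; elim: n => [|n IHn]; first by rewrite big_ord0; exact: clopen_set0.
by rewrite big_ord_recr/=; exact: clopen_setU.
Qed.

Lemma measurable_clopen_set (R : realType) (A : set borel_cantor) :
  clopen_set A -> measurable A.
Proof. by move=> [m]; exact: (@determined_measurable R). Qed.

Lemma cantor_measure_ofE (R : realType) (P : probability borel_cantor R)
  (A : set borel_cantor) : measurable A -> cantor_measure_of P A = P A.
Proof. by move=> mA; rewrite /= /borel_restriction; case: pselect. Qed.

                                                                          
(** * Extension of contents on clopen sets to Borel probabilities *)

(** A copy of the Cantor space whose measurable sets are the clopen sets, so that the extension
    theorem for measures on an algebra applies. *)
Definition clopen_cantor : Type := cantor_space.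

HB.instance Definition _ := Pointed.on clopen_cantor.

HB.instance Definition _ := isAlgebraOfSets.Build default_measure_display
  clopen_cantor clopen_set0 clopen_setU clopen_setC.

Section Extension.
Context {R : realType} (c : set cantor_space -> R).
Context (c_ge0 : forall A, 0 <= c A) (cT : c setT = 1)
  (cU : forall A B, clopen_set A -> clopen_set B -> A `&` B = set0 ->
     c (A `|` B) = c A + c B).

Let content (A : set clopen_cantor) : \bar R := (c A)%:E.

Let c0 : c set0 = 0.
Proof.
have := cU clopen_set0 clopen_set0 (set0I _); rewrite setU0.
by move=> /eqP; rewrite -subr_eq subrr => /eqP.
Qed.

Let content0 : content set0 = 0%E.
Proof. by rewrite /content c0. Qed.

Let content_ge0 A : (0 <= content A)%E.
Proof. by rewrite lee_fin. Qed.

Let content_sigma_additive : semi_sigma_additive content.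
Proof.
move=> F mF tF mUF.
(* By compactness, a countable clopen partition of a clopen set has only finitely many nonempty
   members, so finite additivity already gives countable additivity. *)
have [N NF] : exists N, forall i, (N <= i)%N -> F i = set0.
  have [m dU] := mUF.
  have := determined_compact R dU; rewrite compact_cover.
  case/(_ nat setT F).
  - by move=> i _; have [k dk] := mF i; exact: (determined_open R dk).
  - by [].
  move=> D _ UD; exists (\max_(i <- finmap.enum_fset D) i).+1 => i Di.
  apply/seteqP; split=> // x Fix.
  have [] := UD x; first by exists i.
  move=> j /= jD Fjx; have ij : i = j.
    by apply: tF => //; exists x.
  suff : (i <= \max_(i <- finmap.enum_fset D) i)%N by rewrite leqNgt Di.
  by rewrite ij; exact: leq_bigmax_seq.
have sumE n : (\sum_(0 <= i < n) content (F i))%E =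
    (c (\big[setU/set0]_(i < n) F i))%:E.
  elim: n => [|n IHn]; first by rewrite big_nil big_ord0 c0.
  rewrite big_nat_recr//= big_ord_recr/= IHn cU//.
  - exact: clopen_bigU.
  - exact: mF.
  - apply/seteqP; split=> // x [+ Fnx]; rewrite -bigcup_mkord => -[i /= ni Fix].
    have inE : i = n by apply: tF => //; exists x.
    by rewrite inE ltnn in ni.
apply: cvg_near_cst; exists N => // n /= Nn.
rewrite sumE /content; congr (_%:E); congr c.
apply/seteqP; split=> [x|x [i _ Fix]]; rewrite -bigcup_mkord.
  by move=> [i _ Fix]; exists i.
exists i => //=; rewrite ltnNge; apply/negP => ni.
by move: Fix; rewrite (NF _ (leq_trans Nn ni)).
Qed.

HB.instance Definition _ := isMeasure.Build _ _ _ content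
  content0 content_ge0 content_sigma_additive.

Let sigma_clopen : <<s clopen_set >> = @measurable _ borel_cantor.
Proof.
apply/seteqP; split; apply: smallest_sub; first exact: sigma_algebra_measurable.
- by move=> A; exact: (measurable_clopen_set R).
- exact: smallest_sigma_algebra.
move=> U oU; pose V n := [set x | forall y, agree n x y -> U y].
have -> : U = \bigcup_n V n.
  apply/seteqP; split=> [x Ux|x [n _]]; last by apply.
  have : nbhs x U by move: oU; rewrite openE; apply.
  by move=> /(nbhs_agreeP R)[n nU]; exists n.
apply: sigma_algebra_bigcup => n; apply: sub_sigma_algebra; exists n.
by move=> x y xy Vx z yz; apply: Vx; exact: agree_trans yz.
Qed.

Let ext (A : set borel_cantor) : \bar R := measure_extension content A.

Let extE A : ext A = measure_extension content A. Proof. by []. Qed.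

Let ext0 : ext set0 = 0%E. Proof. by rewrite extE measure0. Qed.

Let ext_ge0 A : (0 <= ext A)%E.
Proof. by rewrite extE; exact: measure_ge0. Qed.

Let ext_sigma_additive : semi_sigma_additive ext.
Proof.
move=> F mF tF mUF.
have := @measure_semi_sigma_additive _ _ _ (measure_extension content) F.
apply=> //.
- by move=> i; move: (mF i); rewrite -sigma_clopen.
- by move: mUF; rewrite -sigma_clopen.
Qed.

HB.instance Definition _ := isMeasure.Build _ _ _ ext
  ext0 ext_ge0 ext_sigma_additive.

Let ext_clopen A : clopen_set A -> ext A = (c A)%:E.
Proof. by move=> cA; rewrite extE /measure_extension measurable_mu_extE. Qed.

Let extT : ext setT = 1%E.
Proof. by rewrite ext_clopen ?cT//; exact: clopen_setT. Qed.

HB.instance Definition _ := Measure_isProbability.Build _ _ _ ext extT.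

Lemma clopen_extension : exists mu : cantor_measure R,
  forall A, clopen_set A -> mu A = (c A)%:E.
Proof.
exists (cantor_measure_of ext) => A cA.
have mA := @measurable_clopen_set R _ cA.
by rewrite (cantor_measure_ofE _ mA) -ext_clopen.
Qed.

End Extension.

(** * Masses of clopen sets and the Prohorov metric *)

Definition word_point (v : seq bool) : cantor_space := nth false v.

Section Mass.
Context {R : realType}.
Implicit Types (mu nu : cantor_measure R) (A B : set cantor_space).

Definition mass mu A : R := fine (mu A).

Lemma massE mu A : clopen_set A -> mu A = (mass mu A)%:E.
Proof.
move=> cA; rewrite fineK//; apply: fin_num_measure.
exact: (measurable_clopen_set R).
Qed.

Lemma mass_ge0 mu A : 0 <= mass mu A.
Proof. by apply: fine_ge0; exact: measure_ge0. Qed.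

Lemma massT mu : mass mu setT = 1.
Proof. by rewrite /mass probability_setT. Qed.

Lemma massU mu A B : clopen_set A -> clopen_set B -> A `&` B = set0 ->
  mass mu (A `|` B) = mass mu A + mass mu B.
Proof.
move=> cA cB AB; apply: EFin_inj; rewrite EFinD -!massE//; last exact: clopen_setU.
by rewrite measureU//; exact: (measurable_clopen_set R).
Qed.

Lemma massC mu A : clopen_set A -> mass mu (~` A) = 1 - mass mu A.
Proof.
move=> cA; apply/eqP; rewrite eq_sym subr_eq addrC -massU ?setICr//.
  by rewrite setUCr massT.
exact: clopen_setC.
Qed.

Lemma mass_le mu A B : clopen_set A -> clopen_set B -> A `<=` B ->
  mass mu A <= mass mu B.
Proof.
move=> cA cB AB; rewrite -lee_fin -!massE//.
by apply: le_measure; rewrite ?inE//; exact: (measurable_clopen_set R).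
Qed.

Lemma mass_le1 mu A : clopen_set A -> mass mu A <= 1.
Proof. by move=> cA; rewrite -(massT mu) mass_le//; exact: clopen_setT. Qed.

Lemma exists_mass (c : set cantor_space -> R) :
  (forall A, clopen_set A -> 0 <= c A) -> c setT = 1 ->
  (forall A B, clopen_set A -> clopen_set B -> A `&` B = set0 ->
     c (A `|` B) = c A + c B) ->
  exists mu : cantor_measure R, forall A, clopen_set A -> mass mu A = c A.
Proof.
move=> c_ge0 cT cU.
(* The extension result wants nonnegativity on all sets, whereas [c] is controlled on clopen sets
   only. *)
pose c' A := if pselect (clopen_set A) then c A else 0.
have c'E A : clopen_set A -> c' A = c A by rewrite /c'; case: pselect.
have [||A B cA cB AB|mu muc] := @clopen_extension R c'.
- by move=> A; rewrite /c'; case: pselect => // cA; exact: c_ge0.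
- by rewrite c'E//; exact: clopen_setT.
- by rewrite !c'E ?cU//; exact: clopen_setU.
- by exists mu => A cA; rewrite /mass muc//= c'E.
Qed.

Lemma thickening_determined m A (d : R) : d <= m.+1%:R^-1 ->
  determined m A -> thickening A d `<=` A.
Proof.
move=> dm dA x; rewrite thickeningE => -[y Ay]; rewrite ballEmdist/= => yx.
apply: dA Ay; apply/(mdist_agreeP R); apply: ltW; exact: lt_le_trans dm.
Qed.

Lemma mass_le_of_mdist m (d : R) mu nu A : mdist mu nu < d ->
  d <= m.+1%:R^-1 -> determined m A -> mass mu A <= mass nu A + d.
Proof.
move=> mnd dm dA; have cA : clopen_set A by exists m.
have [d0 /(_ _ (@measurable_clopen_set R _ cA))[+ _]] := prohorov_ltP mnd.
rewrite -lee_fin EFinD -!massE// => /le_trans; apply; apply: leeD => //.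
apply: le_measure; rewrite ?inE; last exact: thickening_determined dm dA.
  exact: measurable_thickening.
exact: (measurable_clopen_set R).
Qed.

(** The one-sided hypothesis suffices: passing to complements gives the other inequality. A Borel
    set X is replaced by its level-m saturation, which lies between X and the d-thickening of X. *)
Lemma mdist_le_of_mass m (d : R) mu nu : m.+1%:R^-1 < d ->
  (forall A, determined m A -> mass mu A <= mass nu A + d) -> mdist mu nu <= d.
Proof.
move=> md H.
have d0 : 0 < d by apply: lt_trans md; rewrite invr_gt0.
have H' A : determined m A -> mass nu A <= mass mu A + d.
  move=> dA; have cA : clopen_set A by exists m.
  by have := H _ (determinedC dA); rewrite !massC//; lra.
apply: ge_inf; first by exists 0 => e [/ltW].
split=> // X mX.
pose S := [set y | exists2 x, (X : set cantor_space) x & agree m x y].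
have dS : determined m S.
  by move=> x y xy [z Xz zx]; exists z => //; exact: agree_trans xy.
have cS : clopen_set S by exists m.
have mS := @measurable_clopen_set R _ cS.
have XS : X `<=` S by move=> x Xx; exists x.
have SX : S `<=` thickening (X : set cantor_space) d.
  rewrite thickeningE => y [x Xx xy]; exists x => //; rewrite ballEmdist/=.
  by apply: le_lt_trans md; exact/mdist_agreeP.
have key (mu' nu' : cantor_measure R) : mass mu' S <= mass nu' S + d ->
    (mu' X <= nu' (thickening (X : set cantor_space) d) + d%:E)%E.
  rewrite -lee_fin EFinD -!massE// => Sd.
  apply: (@le_trans _ _ (mu' S)); first by apply: le_measure; rewrite ?inE.
  apply: (le_trans Sd); apply: leeD => //.
  by apply: le_measure; rewrite ?inE//; exact: measurable_thickening.
by split; apply: key; [exact: H|exact: H'].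
Qed.

Lemma mass_inj mu nu :
  (forall A, clopen_set A -> mass mu A = mass nu A) -> mu = nu.
Proof.
move=> H; apply: (@mdist_positivity R); apply/eqP; rewrite eq_le mdist_ge0 andbT.
apply/ler_addgt0Pl => e e0; rewrite addr0.
have [n /(_ n (leqnn n)) ne] := invS_lt_ex e0.
apply: mdist_le_of_mass ne _ => A dA.
by rewrite H ?lerDl ?ltW//; exists n.
Qed.

(** The form in which neighborhoods are used below. The bound [d <= 1] lets [d] and smaller positive
    numbers serve as weights of convex combinations. *)
Lemma nbhs_mass mu (U : set (cantor_measure R)) : nbhs mu U ->
  exists m (d : R), [/\ 0 < d, d <= 1 & forall n nu, (m <= n)%N ->
    (forall A, determined n A -> mass mu A <= mass nu A + d) -> U nu].
Proof.
move=> /nbhs_ballP[e /= e0 eU].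
have e20 : 0 < Num.min (e / 2) 1 by rewrite lt_min ltr01 divr_gt0.
have [m mP] := invS_lt_ex e20; exists m, (Num.min (e / 2) 1); split => //.
  by rewrite ge_min lexx orbT.
move=> n nu mn H; apply: eU; rewrite ballEmdist/=.
apply: (le_lt_trans (mdist_le_of_mass (mP _ mn) H)).
by rewrite gt_min ltr_pdivrMr// ltr_pMr// ltrDl ltr01.
Qed.

Lemma mix_exists (s : R) mu nu : 0 <= s <= 1 -> exists la : cantor_measure R,
  forall A, clopen_set A -> mass la A = (1 - s) * mass mu A + s * mass nu A.
Proof.
move=> s01; apply: exists_mass.
- move=> A cA; have := mass_ge0 mu A; have := mass_ge0 nu A.
  by move=> h1 h2; apply: addr_ge0; apply: mulr_ge0 => //; lra.
- by rewrite !massT; lra.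
- by move=> A B cA cB AB; rewrite !massU//; lra.
Qed.

Lemma bary_exists (I : finType) (a : I -> R) (nu : I -> cantor_measure R) :
  (forall i, 0 <= a i) -> \sum_i a i = 1 -> exists la : cantor_measure R,
  forall A, clopen_set A -> mass la A = \sum_i a i * mass (nu i) A.
Proof.
move=> a0 a1; apply: exists_mass.
- by move=> A cA; apply: sumr_ge0 => i _; rewrite mulr_ge0// mass_ge0.
- by rewrite -a1; apply: eq_bigr => i _; rewrite massT mulr1.
- move=> A B cA cB AB; rewrite -big_split/=; apply: eq_bigr => i _.
  by rewrite massU// mulrDr.
Qed.

Lemma mass_sum_words mu m A : determined m A ->
  mass mu A = \sum_(v : m.-tuple bool)
    mass mu [set x | agree m (word_point v) x] * (word_point v \in A)%:R.
Proof.
move=> dA; pose word (x : cantor_space) := [tuple x i | i < m].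
have wordP (v : m.-tuple bool) x : agree m (word_point v) x <-> word x = v.
  split=> [vx|<- i im]; last first.
    by rewrite /word_point (nth_map (Ordinal im)) ?size_enum_ord// nth_enum_ord.
  apply: eq_from_tnth => i; rewrite tnth_mktuple -vx//.
  by rewrite /word_point -tnth_nth.
have dw (P : pred (m.-tuple bool)) : determined m [set x | A x /\ P (word x)].
  move=> x y xy [Ax Px]; split; first exact: dA Ax.
  suff <- : word x = word y by [].
  by apply: eq_from_tnth => i; rewrite !tnth_mktuple xy.
have cw (P : pred (m.-tuple bool)) : clopen_set [set x | A x /\ P (word x)].
  by exists m.
have sum_seq (s : seq (m.-tuple bool)) : uniq s ->
    mass mu [set x | A x /\ word x \in s] = \sum_(v <- s)
      mass mu [set x | agree m (word_point v) x] * (word_point v \in A)%:R.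
  elim: s => [_|v s IHs /andP[vs us]].
    rewrite big_nil (_ : [set _ | _] = set0) ?/mass ?measure0//.
    by apply/seteqP; split=> // x [].
  rewrite big_cons -IHs//.
  have -> : [set x | A x /\ word x \in v :: s] =
      [set x | A x /\ word x == v] `|` [set x | A x /\ word x \in s].
    apply/seteqP; split=> x /=; rewrite inE.
      by move=> [Ax /orP[]]; [left|right].
    by move=> [[Ax xv]|[Ax xs]]; split=> //; apply/orP; [left|right].
  rewrite massU//; first last.
  - apply/seteqP; split=> // x [[_ /eqP xv] [_ xs]].
    by rewrite -xv xs in vs.
  - exact: (cw (mem s)).
  - exact: (cw (pred1 v)).
  congr (_ + _); have [vA|vA] := boolP (word_point v \in A).
    rewrite mulr1; congr (mass mu _); apply/seteqP; split=> x /=.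
      by move=> [_ /eqP xv]; apply/wordP.
    move=> vx; split; last exact/eqP/wordP.
    by apply: dA vx _; exact: set_mem.
  rewrite mulr0 (_ : [set _ | _] = set0) ?/mass ?measure0//.
  apply/seteqP; split=> // x [Ax /eqP/wordP vx]; move/negP: vA; apply.
  by apply: mem_set; apply: dA Ax; exact: agree_sym.
rewrite -sum_seq ?index_enum_uniq//; congr (mass mu _); apply/seteqP.
by split=> [x Ax|x []//]; split=> //; rewrite mem_index_enum.
Qed.

Lemma dirac_exists (x : cantor_space) : exists la : cantor_measure R,
  forall A, clopen_set A -> mass la A = (x \in A)%:R.
Proof.
apply: exists_mass => [A cA| |A B cA cB AB]; first by rewrite ler0n.
  by rewrite in_setT.
rewrite in_setU; case: (boolP (x \in A)) => xA; case: (boolP (x \in B)) => xB /=;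
  rewrite ?addr0 ?add0r//.
have : (A `&` B) x by split; apply: set_mem.
by rewrite AB.
Qed.

End Mass.
                                                 

(** * Maps acting on words of length m *)

Definition level_map (f : cantor_space -> cantor_space) (m : nat) : Prop :=
  forall x y, agree m x y -> agree m (f x) (f y).

Section LevelMap.
Context (f : cantor_space -> cantor_space) (m : nat) (fm : level_map f m).

Lemma agree_iter n x y : agree m x y -> agree m (iter n f x) (iter n f y).
Proof. by move=> xy; elim: n => //= n IHn; exact: fm. Qed.

Lemma determined_preimage n A :
  determined m A -> determined m (iter n f @^-1` A).
Proof. by move=> dA x y /(@agree_iter n) /dA. Qed.

Lemma pigeonhole (u : nat -> cantor_space) :
  exists i j, [/\ (i < j)%N, (j <= 2 ^ m)%N & agree m (u i) (u j)].
Proof.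
pose code (i : 'I_(2 ^ m).+1) := [tuple u i k | k < m].
have /injectivePn[i [j ij cij]] : ~~ injectiveb code.
  apply/negP => /injectiveP /leq_card.
  by rewrite card_ord card_tuple card_bool ltnn.
have uij : agree m (u i) (u j).
  move=> k km; have := congr1 (fun t => tnth t (Ordinal km)) cij.
  by rewrite !tnth_mktuple.
have [lt_ij|lt_ji|/val_inj eij] := ltngtP i j; last by rewrite eij eqxx in ij.
- by exists i, j; rewrite lt_ij -ltnS ltn_ord.
- by exists j, i; rewrite lt_ji -ltnS ltn_ord; split=> //; exact: agree_sym.
Qed.

(** There are 2^m words, so the word orbit repeats within its first 2^m + 1 terms; this bounds both
    the preperiod and the period by 2^m. *)
Lemma eventually_periodic x : exists2 d, (1 <= d <= 2 ^ m)%N &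
  forall a l, (2 ^ m <= a)%N -> agree m (iter (a + d * l) f x) (iter a f x).
Proof.
have [i [j [ij jm xij]]] := pigeonhole (fun n => iter n f x).
exists (j - i)%N; first by rewrite subn_gt0 ij (leq_trans (leq_subr _ _)).
move=> a l ma; elim: l => [|l IHl]; first by rewrite muln0 addn0.
apply: agree_trans _ IHl; set b := (j - i)%N.
have -> : (a + b * l.+1 = (a + b * l - i) + j)%N.
  rewrite mulnS /b; have := ltnW ij; move: ((j - i) * l)%N => c; lia.
have {2}-> : (a + b * l = (a + b * l - i) + i)%N by lia.
by rewrite !iterD; apply: agree_iter; exact: agree_sym.
Qed.

Definition level_periodic (x : cantor_space) : Prop :=
  exists2 n, (1 <= n)%N & agree m (iter n f x) x.

Lemma level_periodic_iter x a : (2 ^ m <= a)%N -> level_periodic (iter a f x).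
Proof.
move=> ma; have [d /andP[d1 _] xd] := eventually_periodic x.
by exists d => //; rewrite -iterD addnC; have := xd a 1%N ma; rewrite muln1.
Qed.

Lemma determined_level_periodic : determined m level_periodic.
Proof.
move=> x y xy [n n1 nx]; exists n => //; apply: agree_trans _ (xy).
by apply: agree_trans _ nx; apply: agree_iter; exact: agree_sym.
Qed.

Lemma level_periodicM x n k : agree m (iter n f x) x ->
  agree m (iter (n * k) f x) x.
Proof.
move=> nx; elim: k => [|k IHk]; first by rewrite muln0.
by rewrite mulnS addnC iterD; apply: agree_trans _ IHk; exact: agree_iter.
Qed.

(** A common return time for all cyclic words: N! is a multiple of the eventual period d. The return
    time n of x is not bounded by N, so x is first moved n 2^m steps, past the preperiod, without
    changing its word. *)
Lemma level_periodic_fact x N : level_periodic x -> (2 ^ m <= N)%N ->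
  agree m (iter N`! f x) x.
Proof.
move=> [n n1 nx] mN; have [d /andP[d1 dm] xd] := eventually_periodic x.
have mn : (2 ^ m <= n * 2 ^ m)%N by rewrite leq_pmull.
have /dvdnP[l Nl] : (d %| N`!)%N by rewrite dvdn_fact// d1 (leq_trans dm).
apply: (@agree_trans _ (iter (N`! + n * 2 ^ m) f x)).
  rewrite iterD; apply: agree_iter; apply: agree_sym; exact: level_periodicM.
rewrite addnC Nl (mulnC l); apply: agree_trans (xd _ l mn) _.
exact: level_periodicM.
Qed.

End LevelMap.

(** * Invariant measures obtained by averaging along orbits *)

Lemma sum_periodic (R : realType) (phi : nat -> R) d k :
  (forall j, phi (j + d)%N = phi j) ->
  \sum_(0 <= j < k * d) phi j = k%:R * \sum_(0 <= j < d) phi j.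
Proof.
move=> phid; elim: k => [|k IHk]; first by rewrite mul0n big_nil mul0r.
rewrite mulSn addnC (@big_cat_nat _ _ _ (k * d)%N)//= ?leq_addr// IHk.
rewrite -natr1 mulrDl mul1r; congr (_ + _).
rewrite -{1}[(k * d)%N]add0n big_addn addKn; apply: eq_bigr => j _.
by elim: {IHk} k => [|k <-]; rewrite ?mul0n ?addn0// mulSn (addnC d) addnA phid.
Qed.

Section Invariant.
Context {R : realType} (f : cantor_map R).
Implicit Types (mu : cantor_measure R) (x : cantor_space).

Lemma mass_iter m n A mu : level_map f m -> determined m A ->
  mass (iter n (induced_map f) mu) A = mass mu (iter n f @^-1` A).
Proof.
move=> fm; elim: n A => [//|n IHn] A dA.
rewrite iterS /mass induced_mapE; last exact: (@determined_measurable R m).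
by apply: IHn; exact: (@determined_preimage _ _ fm 1).
Qed.

Context (f_levels : forall n, exists2 m, (n <= m)%N & level_map f m).

Lemma clopen_level A :
  clopen_set A -> exists2 m, level_map f m & determined m A.
Proof.
move=> [n dA]; have [m nm fm] := f_levels n.
by exists m => //; exact: determinedW dA.
Qed.

Lemma measure_inj mu nu :
  (forall m A, level_map f m -> determined m A -> mass mu A = mass nu A) ->
  mu = nu.
Proof. by move=> H; apply: mass_inj => A /clopen_level[m fm dA]; exact: H dA. Qed.

Let visits x p n (A : set cantor_space) : R :=
  n`!%:R^-1 * \sum_(0 <= j < n`!) (iter (n`! + p * j) f x \in A)%:R.

Let fact_neq0 n : n`!%:R != 0 :> R.
Proof. by rewrite pnatr_eq0 -lt0n fact_gt0. Qed.

Lemma agree_fact m x a b n : level_map f m -> (2 ^ m <= n)%N ->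
  (2 ^ m <= a)%N -> agree m (iter (a + n`! * b) f x) (iter a f x).
Proof.
move=> fm mn ma; have [d /andP[d1 dm] xd] := eventually_periodic fm x.
have /dvdnP[l ->] : (d %| n`!)%N by rewrite dvdn_fact// d1 (leq_trans dm).
by rewrite mulnAC mulnC; exact: xd.
Qed.

Let visits_cst x p m A : level_map f m -> determined m A ->
  exists c, forall n, (2 ^ m <= n)%N -> visits x p n A = c.
Proof.
move=> fm dA; have [d /andP[d1 dm] xd] := eventually_periodic fm x.
have inA y z : agree m y z -> (y \in A) = (z \in A).
  by move=> yz; apply/idP/idP; rewrite !inE; apply: dA => //; exact: agree_sym.
pose N := (2 ^ m)%N; pose phi j : R := (iter (N`! + p * j) f x \in A)%:R.
exists (d%:R^-1 * \sum_(0 <= j < d) phi j) => n mn.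
have leN k : (k <= k`!)%N.
  by case: k => // k; rewrite factS leq_pmulr// fact_gt0.
have dn k : (N <= k)%N -> (d %| k`!)%N.
  by move=> Nk; rewrite dvdn_fact// d1 (leq_trans dm).
have /dvdnP[l nl] := dn _ mn.
(* The starting time n! may be replaced by the fixed N!, as their difference is a multiple of the
   period d. *)
have -> : visits x p n A = n`!%:R^-1 * \sum_(0 <= j < n`!) phi j.
  congr (_ * _); apply: eq_bigr => j _; rewrite /phi; congr (_ %:R).
  congr (nat_of_bool _); apply: inA.
  have : (d %| n`! - N`!)%N by rewrite dvdn_sub// dn.
  have Nn : (N`! <= n`!)%N by exact: leq_fact.
  move=> /dvdnP[k nNk].
  have -> : (n`! + p * j = (N`! + p * j) + d * k)%N by rewrite (mulnC d) -nNk; lia.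
  by apply: xd; rewrite (leq_trans (leN _))// leq_addr.
rewrite {2}nl sum_periodic; last first.
  move=> j; rewrite /phi; congr (_ %:R); congr (nat_of_bool _); apply: inA.
  rewrite mulnDr addnA (mulnC p d); apply: xd.
  by rewrite (leq_trans (leN _))// leq_addr.
rewrite mulrA; congr (_ * _); rewrite nl natrM.
have l0 : l%:R != 0 :> R.
  by have := fact_neq0 n; rewrite nl natrM mulf_eq0 negb_or => /andP[].
have d0 : d%:R != 0 :> R by rewrite pnatr_eq0 -lt0n.
by rewrite invfM mulrAC mulVf// mul1r.
Qed.

(** The eventual visit frequencies are additive on clopen sets, hence come from a measure. It is
    fixed by the p-th iterate because shifting the sum by one term changes only its endpoints, which
    carry the same word. *)
Lemma invariant_measure x p : exists2 mu : cantor_measure R,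
  iter p (induced_map f) mu = mu &
  forall m A, level_map f m -> determined m A ->
    (exists N, forall n j, (N <= n)%N -> A (iter (n`! + p * j) f x)) ->
    mass mu A = 1.
Proof.
have /choice[c cP] : forall A, exists c, clopen_set A ->
    exists N, forall n, (N <= n)%N -> visits x p n A = c.
  move=> A; have [/clopen_level[m fm dA]|nA] := pselect (clopen_set A).
    by have [c cP] := visits_cst x p fm dA; exists c => _; exists (2 ^ m)%N.
  by exists 0.
have visits1 n A : (forall j, A (iter (n`! + p * j) f x)) ->
    visits x p n A = 1.
  move=> nA; rewrite /visits; under eq_bigr do rewrite mem_set//.
  by rewrite sumr_const_nat subn0 mulVf.
have [A cA| |A B cA cB AB|mu mu_c] := @exists_mass R c.
- have [N /(_ N (leqnn N)) <-] := cP _ cA.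
  by rewrite /visits mulr_ge0 ?invr_ge0// sumr_ge0.
- have [N /(_ N (leqnn N)) <-] := cP _ clopen_setT.
  exact: visits1.
- have [N NP] := cP _ (clopen_setU cA cB).
  have [N1 NP1] := cP _ cA; have [N2 NP2] := cP _ cB.
  pose n := maxn N (maxn N1 N2).
  rewrite -(NP n) -?(NP1 n) -?(NP2 n) /n ?leq_max ?leqnn ?orbT//.
  rewrite /visits -mulrDr -big_split/=; congr (_ * _); apply: eq_bigr => j _.
  rewrite -natrD in_setU; set y := iter _ _ _.
  case: (boolP (y \in A)) => yA; case: (boolP (y \in B)) => yB //=.
  have : (A `&` B) y by split; exact: set_mem.
  by rewrite AB.
exists mu.
  apply: measure_inj => m A fm dA.
  have cA : clopen_set A by exists m.
  have cpA : clopen_set (iter p f @^-1` A).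
    by exists m; exact: determined_preimage.
  rewrite (mass_iter _ _ fm dA) !mu_c//.
  have [N1 NP1] := cP _ cA; have [N2 NP2] := cP _ cpA.
  pose n := maxn (2 ^ m) (maxn N1 N2).
  rewrite -(NP1 n) -?(NP2 n) /n ?leq_max ?leqnn ?orbT// -/n.
  rewrite /visits; congr (_ * _).
  pose phi j : R := (iter (n`! + p * j) f x \in A)%:R.
  rewrite (eq_bigr (fun j => phi j.+1)); last first.
    by move=> j _; rewrite /phi mulnS addnCA (iterD p).
  (* The two sums differ only in the terms at indices 0 and n!; these agree since n! p is a multiple
     of the eventual period at level m. *)
  apply: (@addrI _ (phi 0%N)); rewrite -big_nat_recl// big_nat_recr//= addrC.
  congr (_ + _); rewrite /phi muln0 addn0; congr (_ %:R).
  have nm : (2 ^ m <= n`!)%N.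
    apply: (@leq_trans n); first by rewrite leq_max leqnn.
    by case: (n) => // k; rewrite factS leq_pmulr// fact_gt0.
  have ag : agree m (iter (n`! + n`! * p) f x) (iter n`! f x).
    by apply: agree_fact => //; rewrite leq_max leqnn.
  rewrite mulnC; congr (nat_of_bool _).
  by apply/idP/idP; rewrite !inE; apply: dA => //; exact: agree_sym.
move=> m A fm dA [N NP]; have cA : clopen_set A by exists m.
have [N1 NP1] := cP _ cA.
rewrite mu_c// -(NP1 (maxn N N1)) ?leq_maxr// visits1// => j.
by apply: NP; rewrite leq_maxl.
Qed.

End Invariant.
                   

(** * Richness, an open and dense condition *)

Definition spread (f : cantor_space -> cantor_space) (m p : nat)
    (x : cantor_space) : Prop :=
  forall i j, agree m (iter i f x) (iter j f x) -> i = j %[mod p].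

                                                                                
                                                                     
(** The noncyclic image word serves the empty interior; the spread orbits give measures of exact
    period n+1, and having two disjoint ones lets one avoid any prescribed measure. *)
Definition rich (f : cantor_space -> cantor_space) (n : nat) : Prop :=
  exists m, [/\ (n <= m)%N, level_map f m,
    (exists z, ~ level_periodic f m (f z)) &
    exists x y, [/\ spread f m n.+1 x, spread f m n.+1 y &
      forall i j, ~ agree m (iter i f x) (iter j f y)]].

(** A map agreeing with f on the first m coordinates of every value induces the same dynamics on
    words of length m, and richness at level m speaks of nothing else. *)
Lemma rich_perturb f n : rich f n -> exists m,
  forall g : cantor_space -> cantor_space,
    (forall x, agree m (f x) (g x)) -> rich g n.
Proof.
move=> [m [nm fm [z zN] [x [y [xs ys xy]]]]]; exists m => g fg; exists m.
have fgi i t : agree m (iter i f t) (iter i g t).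
  elim: i => [//|i IHi]; rewrite !iterS; apply: (agree_trans (fm _ _ IHi)).
  exact: fg.
have transfer i j t u : agree m (iter i g t) (iter j g u) ->
    agree m (iter i f t) (iter j f u).
  move=> tu; apply: (agree_trans (fgi _ _)); apply: (agree_trans tu).
  by apply: agree_sym; exact: fgi.
split=> //.
- move=> t u /fm ftu; apply: agree_trans (fg u); apply: agree_trans _ (ftu).
  exact: agree_sym.
- exists z => -[k k1 kz]; apply: zN; exists k => //.
  by move: kz; rewrite -!iterSr; exact: (transfer _ 1%N).
- by exists x, y; split=> [i j /transfer/xs|i j /transfer/ys|i j /transfer/xy].
Qed.

Lemma uniform_agree (R : realType) (f : cantor_map R) n :
  exists m, forall x y, agree m x y -> agree n (f x) (f y).
Proof.
have /choice[u uP] : forall x, exists m, forall y, agree m x y ->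
    agree n (f x) (f y).
  move=> x; apply/(nbhs_agreeP R) ; apply: (@cts_fun _ _ f).
  by apply/(nbhs_agreeP R); exists n.
have := cantor_space_compact; rewrite compact_cover.
case/(_ cantor_space setT (fun x => [set y | agree (u x) x y])).
- by move=> x _; apply: (determined_open R); exact: determined_agree.
- by move=> x _; exists x.
move=> D _ cD; exists (\max_(x <- finmap.enum_fset D) u x) => x y xy.
have [z /= zD zx] := cD x I.
apply: (agree_trans (agree_sym (uP _ _ zx))); apply: uP.
apply: (agree_trans zx); apply: agreeW xy.
exact: leq_bigmax_seq.
Qed.

Lemma locally_constant_continuous (R : realType) m
    (g : cantor_space -> cantor_space) :
  (forall x y, agree m x y -> g x = g y) -> continuous g.
Proof.
move=> gm x U gxU; apply/(nbhs_agreeP R); exists m => y /gm gxy.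
by rewrite /= -gxy; exact: nbhs_singleton.
Qed.

                                                                           
                                                     
(** Behind the first n coordinates sit p cells rotated cyclically, a cell kept forever, and a cell
    that is cleared while its old content moves to the next one. All further cells are set to
    [false]. *)
Definition register (n p : nat) (x : cantor_space) (r : nat) : bool :=
  if (r < p)%N then x (n + (r + p.-1) %% p)%N
  else if r == p then x (n + p)%N
  else (r == p.+2) && x (n + p.+1)%N.

Definition with_register (n p : nat) (f : cantor_space -> cantor_space)
    (x : cantor_space) : cantor_space :=
  fun i => if (i < n)%N then f x i else register n p x (i - n).

Section Register.
Context (f : cantor_space -> cantor_space) (n k m : nat).
Context (fm : forall x y, agree m x y -> agree n (f x) (f y)).

Let p := k.+1.
Let M := maxn (n + p.+3) m.
Let g := with_register n p f.

Lemma with_register_locally_constant x y : agree M x y -> g x = g y.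
Proof.
move=> xy; apply/funext => i; rewrite /g /with_register.
case: ifPn => [lt_in|_].
  by apply: fm lt_in; apply: agreeW xy; exact: leq_maxr.
have xyM r : (r < p.+3)%N -> x (n + r)%N = y (n + r)%N.
  by move=> rp; apply: xy; rewrite leq_max ltn_add2l rp.
rewrite /register; case: ifP => _; last first.
  by case: ifP => _; rewrite xyM//; lia.
rewrite xyM//; apply: (@leq_trans p); first by rewrite ltn_pmod.
by rewrite -addn3 leq_addr.
Qed.

Let gE x r : g x (n + r)%N = register n p x r.
Proof. by rewrite /g /with_register ltnNge leq_addr addKn. Qed.

Let g_rot x r : (r < p)%N -> g x (n + r)%N = x (n + (r + p.-1) %% p)%N.
Proof. by move=> rp; rewrite gE /register rp. Qed.

Let g_keep x : g x (n + p)%N = x (n + p)%N.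
Proof. by rewrite gE /register ltnn eqxx. Qed.

Let g_clear x : g x (n + p.+1)%N = false.
Proof.
rewrite gE /register; do 2 (case: ifP => [|_]; first lia).
by apply/andP; lia.
Qed.

Let g_move x : g x (n + p.+2)%N = x (n + p.+1)%N.
Proof. by rewrite gE /register eqxx; do 2 (case: ifP => [|_]; first lia). Qed.

Let ltM r : (r < p.+3)%N -> (n + r < M)%N.
Proof. by move=> rp; rewrite leq_max ltn_add2l rp. Qed.

Lemma with_register_level : level_map g M.
Proof. by move=> x y /with_register_locally_constant ->. Qed.

(** A bit set in the cleared cell appears in the next cell after one step and never again, since the
    cleared cell stays empty from then on. *)
Lemma with_register_transient : exists x, ~ level_periodic g M (g x).
Proof.
exists (fun i => i == (n + p.+1)%N) => -[[//|j] _ /(_ (n + p.+2)%N)].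
rewrite iterS !g_move eqxx.
have -> : iter j g (g (fun i => i == (n + p.+1)%N)) (n + p.+1)%N = false.
  by rewrite -iterSr iterS g_clear.
by move=> H; have := H (ltM (ltnSn _)).
Qed.

(** A single bit in the rotating block records time modulo p; the kept cell holds [b] and separates
    the two orbits. *)
Let seed b : cantor_space := fun i => (i == n) || (b && (i == (n + p)%N)).

Let iter_rot b i r : (r < p)%N -> iter i g (seed b) (n + r)%N = (r == i %% p)%N.
Proof.
elim: i r => [|i IHi] r rp.
  by rewrite mod0n /seed /= eqn_add2l (ltn_eqF rp) andbF orbF -{2}[n]addn0 eqn_add2l.
rewrite iterS g_rot// IHi ?ltn_pmod// -(eqn_modDr 1) -addnA addn1 /= modnDr addn1.
by rewrite [X in X == _]modn_small.
Qed.

Let iter_keep b i : iter i g (seed b) (n + p)%N = b.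
Proof.
elim: i => [|i IHi]; last by rewrite iterS g_keep.
by rewrite /seed /= eqxx andbT -{2}[n]addn0 eqn_add2l.
Qed.

Lemma with_register_spread : exists x y,
  [/\ spread g M p x, spread g M p y &
    forall i j, ~ agree M (iter i g x) (iter j g y)].
Proof.
have spread_seed b : spread g M p (seed b).
  move=> i j /(_ (n + i %% p)%N); rewrite !iter_rot ?ltn_pmod// eqxx => H.
  apply/eqP; rewrite -H// ltM//; apply: (@leq_trans p); first by rewrite ltn_pmod.
  by rewrite -addn3 leq_addr.
exists (seed false), (seed true); split=> // i j /(_ (n + p)%N).
rewrite !iter_keep => H; have := H (ltM _).
by rewrite -addn3 -addn1 leq_add2l => /(_ isT).
Qed.

End Register.

Lemma rich_dense (R : realType) (f : cantor_map R) n k :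
  exists2 g : cantor_map R, rich g k & forall x, agree n (f x) (g x).
Proof.
(* Keeping [n] coordinates makes g close to f; keeping [k] of them puts the level of richness above
   [k]. *)
have [m fm] := uniform_agree f (maxn n k).
pose g := with_register (maxn n k) k.+1 f.
have gM x y := @with_register_locally_constant f (maxn n k) k m fm x y.
have g_cts : continuous g by exact: (locally_constant_continuous R gM).
exists (mkcts g_cts : continuousType cantor_space cantor_space).
  exists (maxn (maxn n k + k.+4) m); split.
  - by rewrite leq_max (leq_trans (leq_maxr n k)) ?leq_addr.
  - exact: (@with_register_level f (maxn n k) k m fm).
  - exact: (@with_register_transient f (maxn n k) k m).
  - exact: (@with_register_spread f (maxn n k) k m).
by move=> x i ni; change (f x i = g x i); rewrite /g /with_register leq_max ni.
Qed.

Lemma generic_rich (R : realType) (P : cantor_map R -> Prop) :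
  (forall f : cantor_map R, (forall n, rich f n) -> P f) -> generic P.
Proof.
(* First category asks for equality with the union, hence the intersection with the failure of
   [P]. *)
move=> richP; exists (fun n => [set f | ~ P f /\ ~ rich f n]); last first.
  apply/seteqP; split=> [f nPf|f [n _ []]//].
  have /existsNP[n fn] : ~ forall n, rich f n by move=> /richP.
  by exists n.
move=> n; apply/seteqP; split=> // f.
rewrite /interior => /(@nbhs_ballP R (cantor_map R))[e /= e0 eA].
have [k /(_ k (leqnn k)) ke] := invS_lt_ex e0.
have [g gn fg] := rich_dense f k n.
have /eA gA : ball f e g.
  rewrite ballEmdist/=; change (cantor_map_dist f g < e).
  have [[x ->] _] := cantor_map_dist_max f g.
  by apply: le_lt_trans ke; apply/mdist_agreeP; exact: fg.
have [m mP] := rich_perturb gn.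
have /gA[h [[_ hn]]] : nbhs g (ball g (m.+1%:R^-1 : R)).
  by apply: nbhsx_ballx; rewrite invr_gt0.
rewrite ballEmdist/= => /ltW gh; apply: hn; apply: mP => x.
apply/(mdist_agreeP R); apply: le_trans gh.
by have [_] := cantor_map_dist_max g h.
Qed.
                        

(** * Recurrence properties of the induced map of a rich map *)

Section GenericDynamics.
Context {R : realType} (f : cantor_map R) (f_rich : forall n, rich f n).
Implicit Types mu nu la : cantor_measure R.

Local Notation F := (induced_map f).

Let f_levels n : exists2 m, (n <= m)%N & level_map f m.
Proof. by have [m [nm fm _ _]] := f_rich n; exists m. Qed.

Definition level_supported mu : Prop :=
  forall m, level_map f m -> mass mu (~` level_periodic f m) = 0.

(** After 2^m exact steps every word is cyclic, so no mass is left on the others. The last 2^m steps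
    of a chain ending at mu imitate this with an error of at most d each. *)
Lemma chain_recurrent_supported mu : chain_recurrent F mu -> level_supported mu.
Proof.
move=> mu_cr m fm; pose N := (2 ^ m)%N.
pose A := ~` level_periodic f m.
have dA : determined m A by apply: determinedC; exact: determined_level_periodic.
have NA : iter N f @^-1` A = set0.
  apply/seteqP; split=> // x; apply; exact: level_periodic_iter.
apply/eqP; rewrite eq_le mass_ge0 andbT; apply/ler_addgt0Pl => e e0; rewrite addr0.
pose d := Num.min (e / N.+1%:R) m.+1%:R^-1.
have d0 : 0 < d by rewrite lt_min divr_gt0//= invr_gt0.
have [k [c [k1 c0 ck cd]]] := mu_cr d d0.
(* The closed chain is repeated periodically so that 2^m steps precede a return to mu, even when k
   is small. *)
pose c' n := c (n %% k)%N.
have cd' n : mdist (F (c' n)) (c' n.+1) < d.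
  suff -> : c' n.+1 = c (n %% k).+1 by apply: cd; rewrite ltn_pmod.
  rewrite /c' -addn1 -modnDml addn1.
  have : ((n %% k).+1 <= k)%N by rewrite ltn_pmod.
  by rewrite leq_eqVlt => /predU1P[->|/modn_small ->//]; rewrite modnn c0 ck.
have step j n B : determined m B ->
    mass (c' (j + n)%N) B <= mass (c' j) (iter n f @^-1` B) + n%:R * d.
  elim: n B => [|n IHn] B dB; first by rewrite addn0 mul0r addr0.
  have dfB : determined m (f @^-1` B) by exact: (@determined_preimage _ _ fm 1).
  rewrite addnS -natr1 mulrDl mul1r addrA.
  apply: (@le_trans _ _ (mass (F (c' (j + n)%N)) B + d)).
    apply: (@mass_le_of_mdist _ m) => //; last by rewrite ge_min lexx orbT.
    by rewrite metric_sym.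
  rewrite lerD2r (mass_iter 1 _ fm dB); exact: (IHn _ dfB).
have := step (N * k - N)%N N A dA; rewrite subnK ?leq_pmulr//.
rewrite NA /c' modnMl c0; move=> /le_trans; apply.
have -> : mass (c ((N * k - N) %% k)%N) set0 = 0 by rewrite /mass measure0.
rewrite add0r; apply: (@le_trans _ _ (N%:R * (e / N.+1%:R))).
  by rewrite ler_wpM2l// ge_min lexx.
rewrite mulrCA ler_piMr//; first exact: ltW.
by rewrite ler_pdivrMr// mul1r ler_nat.
Qed.

(** On cyclic words the iterate of order (2^m)! is the identity at level m, so it preserves all
    level-m masses of mu. *)
Lemma supported_recurrent mu : level_supported mu -> recurrent F mu.
Proof.
move=> mu_s U /nbhs_mass[m0 [d [d0 _ HU]]]; have [m mm fm] := f_levels m0.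
exists (2 ^ m)`!%N; first exact: fact_gt0.
apply: HU mm _ => A dA; rewrite (mass_iter _ _ fm dA).
set g := iter _ f; pose P := level_periodic f m.
have dP : determined m P by exact: determined_level_periodic.
have dgA : determined m (g @^-1` A) by exact: determined_preimage.
have cP : clopen_set P by exists m.
have massP B : determined m B -> mass mu B = mass mu (B `&` P).
  move=> dB; rewrite -{1}[B](setUIDK B P).
  rewrite massU; first last.
  - by apply/seteqP; split=> // x [[_ Px] [_]]; apply.
  - by exists m; apply: determinedI => //; exact: determinedC.
  - by exists m; exact: determinedI.
  suff -> : mass mu (B `\` P) = 0 by rewrite addr0.
  apply/eqP; rewrite eq_le mass_ge0 andbT -(mu_s m fm); apply: mass_le.
  - by exists m; apply: determinedI => //; exact: determinedC.
  - exact: clopen_setC.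
  - by move=> x [].
rewrite (massP _ dA) (massP _ dgA).
suff -> : g @^-1` A `&` P = A `&` P by rewrite lerDl ltW.
apply/seteqP; split=> x [Ax Px]; split=> //; apply: dA Ax.
  exact: level_periodic_fact.
by apply: agree_sym; exact: level_periodic_fact.
Qed.

Lemma recurrent_nonwandering mu : recurrent F mu -> nonwandering F mu.
Proof.
move=> mu_r U muU; have [n n1 Un] := mu_r U muU; exists n => //.
exists (iter n F mu); split=> //; exists mu => //; exact: nbhs_singleton.
Qed.

Lemma nonwandering_chain_recurrent mu : nonwandering F mu -> chain_recurrent F mu.
Proof.
move=> mu_nw d d0; have d20 : 0 < d / 2 by rewrite divr_gt0.
have [n0 n0P] := invS_lt_ex d20; have [m nm fm] := f_levels n0.
pose e := Num.min (d / 2) m.+1%:R^-1.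
have e0 : 0 < e by rewrite lt_min d20 invr_gt0/=.
have F_close nu : ball mu e nu -> mdist (F mu) (F nu) <= d / 2.
  rewrite ballEmdist/= => mu_nu; apply: (mdist_le_of_mass (n0P _ nm)) => A dA.
  rewrite !(mass_iter 1 _ fm dA).
  apply: (@le_trans _ _ (mass nu (iter 1 f @^-1` A) + e)).
    apply: (@mass_le_of_mdist _ m _ _ _ _ mu_nu); first by rewrite ge_min lexx orbT.
    exact: determined_preimage.
  by rewrite lerD2l ge_min lexx.
have [n n1 [_ [[nu mu_nu <-] mu_n]]] := mu_nw _ (nbhsx_ballx mu _ e0).
(* The orbit of nu with both ends replaced by mu; when n = 1 both errors fall on the same step,
   hence the halves of d. *)
exists n, (fun i => if i == 0 then mu else if i == n then mu else iter i F nu)%N.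
split=> //; first by rewrite eqxx; case: ifP.
have close_mu : mdist (iter n F nu) mu < d / 2.
  move: mu_n; rewrite ballEmdist/= metric_sym => /lt_le_trans; apply.
  by rewrite ge_min lexx.
move=> i i_n /=; rewrite (ltn_eqF i_n).
have -> : d = d / 2 + d / 2 by rewrite -splitr.
have tri j : (0 < j)%N ->
    mdist (iter j F nu) (if j == n then mu else iter j F nu) < d / 2.
  by move=> j0; case: eqP => [->//|_]; rewrite mdistxx.
case: (posnP i) => [->|i0].
  apply: le_lt_trans (metric_triangle _ (F nu) _) _.
  apply: ler_ltD; first exact: F_close.
  exact: (tri 1%N).
apply: lt_trans (_ : d / 2 < _); last by rewrite ltrDl.
exact: (tri i.+1).
Qed.

(** * Periodic measures of prescribed period *)

Lemma full_mass_meet mu A B : clopen_set A -> clopen_set B ->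
  mass mu A = 1 -> mass mu B = 1 -> A `&` B !=set0.
Proof.
move=> cA cB A1 B1; apply/set0P/eqP => AB.
have := mass_le1 mu (clopen_setU cA cB); rewrite massU// A1 B1.
by rewrite gerDl ler10.
Qed.

Lemma periodic_point_neq p mu : (1 <= p)%N ->
  exists2 nu : cantor_measure R, nu <> mu & periodic_point F p nu.
Proof.
move=> p1; have [m [_ fm _ [x [y]]]] := f_rich p.-1.
rewrite prednK// => -[xs ys xy].
(* The words met at times divisible by p. The averaged measure sits on this set; if it had a period
   i < p, the set would meet its preimage under f^i, and spreading would force p to divide i. *)
pose A z := [set t | exists j, agree m t (iter (p * j) f z)].
have dA z : determined m (A z).
  move=> s t st [j sj]; exists j; apply: agree_trans sj; exact: agree_sym.
have cA z : clopen_set (A z) by exists m.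
have orbit_measure z : spread f m p z ->
    exists2 nu, periodic_point F p nu & mass nu (A z) = 1.
  move=> zs; have [nu nup nu1] := invariant_measure f_levels z p.
  have nuA : mass nu (A z) = 1.
    apply: (nu1 m) => //; exists p => n j pn; exists (n`! %/ p + j)%N.
    rewrite mulnDr (mulnC p (_ %/ _)%N) divnK; last by rewrite dvdn_fact// p1.
    exact: agree_refl.
  exists nu => //; split=> // i /andP[i1 ip] nui.
  have nuA' : mass nu (iter i f @^-1` A z) = 1.
    by rewrite -(mass_iter i nu fm (dA z)) nui.
  have cA' : clopen_set (iter i f @^-1` A z).
    by exists m; exact: determined_preimage.
  have [t [[j tj] [k tk]]] := full_mass_meet (cA z) cA' nuA nuA'.
  have /zs : agree m (iter (i + p * j) f z) (iter (p * k) f z).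
    rewrite iterD; apply: agree_trans _ (tk).
    by apply: agree_iter => //; exact: agree_sym.
  by rewrite addnC mulnC modnMDl mulnC modnMl modn_small// => i0; rewrite i0 in i1.
have [mu_x xp x1] := orbit_measure x xs; have [mu_y yp y1] := orbit_measure y ys.
have [mux|] := pselect (mu_x = mu); last by exists mu_x.
exists mu_y => // muy.
have := full_mass_meet (cA x) (cA y) x1; rewrite mux -muy.
move=> /(_ y1)[t [[j tj] [k tk]]]; apply: (xy (p * j)%N (p * k)%N).
by apply: agree_trans tk; exact: agree_sym.
Qed.

Definition is_mix (s : R) mu nu la : Prop := forall A, clopen_set A ->
  mass la A = (1 - s) * mass mu A + s * mass nu A.

Lemma iter_is_mix s mu nu la j : is_mix s mu nu la ->
  is_mix s (iter j F mu) (iter j F nu) (iter j F la).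
Proof.
move=> mix A /(clopen_level f_levels)[m fm dA].
by rewrite !(mass_iter j _ fm dA) mix//; exists m; exact: determined_preimage.
Qed.

Lemma is_mix_uniq s mu nu la la' : is_mix s mu nu la -> is_mix s mu nu la' ->
  la = la'.
Proof. by move=> mix mix'; apply: mass_inj => A cA; rewrite mix// mix'. Qed.

Lemma is_mix_mass_le s mu nu la A : 0 <= s <= 1 -> is_mix s mu nu la ->
  clopen_set A -> mass mu A <= mass la A + s.
Proof.
move=> /andP[s0 s1] mix cA; rewrite mix//.
have h1 : s * mass mu A <= s by rewrite ler_piMr// mass_le1.
have h2 : 0 <= s * mass nu A by rewrite mulr_ge0// mass_ge0.
by lra.
Qed.

(** Two distinct points of an affine parametrization determine its endpoint at parameter 1. *)
Lemma is_mix_affine s s' mu nu la la' mu' nu' : s != s' ->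
  is_mix s mu nu la -> is_mix s' mu nu la' ->
  is_mix s mu' nu' la -> is_mix s' mu' nu' la' -> nu = nu'.
Proof.
move=> ss' m1 m2 m3 m4; apply: mass_inj => A cA.
have := etrans (esym (m1 A cA)) (m3 A cA).
have := etrans (esym (m2 A cA)) (m4 A cA).
set a := mass mu A; set b := mass nu A; set a' := mass mu' A; set b' := mass nu' A.
move=> e1 e2; apply/eqP; rewrite -subr_eq0.
have : (s - s') * (b - b') == 0.
  have -> : (s - s') * (b - b') =
      (1 - s') * ((1 - s) * a + s * b - ((1 - s) * a' + s * b')) -
      (1 - s) * ((1 - s') * a + s' * b - ((1 - s') * a' + s' * b')) by ring.
  by rewrite e1 e2 !subrr !mulr0 subrr.
by rewrite mulf_eq0 (subr_eq0 s) (negbTE ss').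
Qed.

Lemma uncountable_itv (d : R) : 0 < d -> ~ countable [set` `]0, d[].
Proof.
move=> d0 /countable_lebesgue_measure0; rewrite lebesgue_measure_itv/= lte_fin d0.
by rewrite sube0 => -[/eqP]; rewrite gt_eqF.
Qed.

(** Mixtures of mu with a measure nu of exact period kp are fixed by the iterate of order kp. For
    each smaller j at most one weight s gives a fixed point of the j-th iterate, since two would
    make nu itself fixed by it. *)
Lemma periodic_uncountable p mu U k : periodic_point F p mu -> nbhs mu U ->
  (1 <= k)%N -> ~ countable (U `&` periodic_point F (k * p)%N).
Proof.
move=> [p1 mup _] /nbhs_mass[m0 [d [d0 d1 HU]]] k1.
pose K := (k * p)%N; have K1 : (1 <= K)%N by rewrite muln_gt0 k1.
have [nu nu_mu [_ nuK nu_min]] := periodic_point_neq mu K1.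
have /choice[la laP] : forall s : R, exists la, 0 <= s <= 1 -> is_mix s mu nu la.
  move=> s; have [s01|ns] := pselect (0 <= s <= 1); last by exists mu.
  by have [la mix] := mix_exists mu nu s01; exists la.
have la_mix s : s \in `]0, d[ -> is_mix s mu nu (la s).
  by rewrite in_itv/= => /andP[s0 sd]; apply: laP;
    rewrite (ltW s0) (le_trans (ltW sd)).
have laU s : s \in `]0, d[ -> U (la s).
  move=> s_d; apply: HU (leqnn m0) _ => A dA.
  have cA : clopen_set A by exists m0.
  move: (s_d); rewrite in_itv/= => /andP[s0 sd].
  apply: (@le_trans _ _ (mass (la s) A + s)); last by rewrite lerD2l ltW.
  apply: is_mix_mass_le (la_mix _ s_d) cA.
  by rewrite (ltW s0) (le_trans (ltW sd)).
have laK s : s \in `]0, d[ -> iter K F (la s) = la s.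
  move=> s_d; apply: (@is_mix_uniq s mu nu) => //; last exact: la_mix.
  have := iter_is_mix K (la_mix _ s_d).
  by rewrite nuK iterM iter_fix.
pose B j := [set s | (s \in `]0, d[) /\ iter j F (la s) = la s].
have B_countable j : (1 <= j < K)%N -> countable (B j).
  (* A constant map is injective on [B j], because [B j] has at most one element. *)
  move=> jK; apply/countable_injP; exists (fun _ => 0%N) => s s'.
  rewrite !inE => -[s_d sj] [s'_d s'j] _.
  apply/eqP/negPn/negP => ss'; apply: (nu_min j jK).
  have mj t : t \in `]0, d[ -> iter j F (la t) = la t ->
      is_mix t (iter j F mu) (iter j F nu) (la t).
    by move=> t_d tj; have := iter_is_mix j (la_mix _ t_d); rewrite tj.
  apply/esym; apply: (is_mix_affine ss' (la_mix _ s_d) (la_mix _ s'_d)).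
    exact: mj.
  exact: mj.
have la_inj s s' : s \in `]0, d[ -> s' \in `]0, d[ -> la s = la s' -> s = s'.
  move=> s_d s'_d ss'; apply/eqP/negPn/negP => nss'; apply: nu_mu.
  apply: mass_inj => A cA.
  have := la_mix _ s_d A cA; rewrite ss' (la_mix _ s'_d A cA) => e.
  apply/eqP; rewrite -subr_eq0.
  have : (s - s') * (mass nu A - mass mu A) == 0 by apply/eqP; lra.
  by rewrite mulf_eq0 (subr_eq0 s) (negbTE nss').
move=> /countable_injP[phi phi_inj]; apply: (@uncountable_itv d d0).
pose G := [set s | (s \in `]0, d[) /\ periodic_point F K (la s)].
have G_countable : countable G.
  apply/countable_injP; exists (phi \o la) => s s'.
  rewrite !inE => -[s_d sp] [s'_d s'p] /phi_inj e; apply: la_inj => //.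
  by apply: e; rewrite inE; split=> //; exact: laU.
(* Indices outside the range 1 <= j < K carry [G]; index 0 is the one used. *)
apply: (@sub_countable _ _ _ (\bigcup_j (if (1 <= j < K)%N then B j else G))).
  apply: subset_card_le => s s_d.
  have [[j jK sj]|nB] :=
      pselect (exists2 j : nat, (1 <= j < K)%N & iter j F (la s) = la s).
    by exists j => //; rewrite jK.
  exists 0%N => //=; split=> //; split=> //; first exact: laK.
  by move=> j jK sj; apply: nB; exists j.
apply: bigcup_countable => // j _; case: ifP => // jK; exact: B_countable.
Qed.

Lemma periodic_point_uncountable p : (1 <= p)%N -> ~ countable (periodic_point F p).
Proof.
move=> p1; have [mu0 _] := @dirac_exists R point.
have [mu _ mu1] := periodic_point_neq mu0 (leqnn 1).
have := periodic_uncountable mu1 (@filterT _ (nbhs mu) _) p1.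
by rewrite muln1 setTI; apply.
Qed.

(** * Empty interior of the chain recurrent set in the range *)

Lemma range_not_supported : exists x, ~ level_supported (F x).
Proof.
have [m [_ fm [x xN] _]] := f_rich 0; have [mu mu_x] := @dirac_exists R x.
have dP : determined m (~` level_periodic f m).
  by apply: determinedC; exact: determined_level_periodic.
exists mu => /(_ m fm); rewrite (mass_iter 1 mu fm dP) mu_x.
  by rewrite mem_set// => /eqP; rewrite oner_eq0.
by exists m; exact: (@determined_preimage _ _ fm 1).
Qed.

(** Mix mu with weight d with a measure whose image charges noncyclic words. As F is affine, the
    image of the mixture stays near F mu and still charges them. *)
Lemma nbhs_range_not_chain_recurrent mu U : nbhs (F mu) U ->
  exists2 nu, U (F nu) & ~ chain_recurrent F (F nu).
Proof.
move=> /nbhs_mass[m0 [d [d0 d1 HU]]].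
have [la /existsNP[m /not_implyP[fm la_m]]] := range_not_supported.
have d01 : 0 <= d <= 1 by rewrite (ltW d0).
have [nu mix] := mix_exists mu la d01; exists nu.
  apply: HU (leqnn m0) _ => A dA.
  by apply: (is_mix_mass_le d01 (iter_is_mix 1 mix)); exists m0.
move=> /chain_recurrent_supported/(_ m fm).
have cP : clopen_set (~` level_periodic f m).
  by exists m; apply: determinedC; exact: determined_level_periodic.
rewrite (iter_is_mix 1 mix cP) => /eqP; rewrite paddr_eq0; last first.
- by rewrite mulr_ge0 ?mass_ge0 ?ltW.
- by rewrite mulr_ge0 ?mass_ge0// subr_ge0.
by rewrite [X in _ && X]mulf_eq0 (gt_eqF d0) => /andP[_ /eqP].
Qed.

Lemma chain_recurrent_interior :
  interior (set_val @^-1` chain_recurrent F : set (range F)) = set0.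
Proof.
apply/seteqP; split=> // a; rewrite /interior /=.
rewrite nbhsE => -[B [[V oV VB] Ba] BCR].
have {}VB : set_val @^-1` V = B := VB.
have [mu _ muE] := set_valP a.
have /nbhs_range_not_chain_recurrent[nu Vnu] : nbhs (F mu) V.
  by apply: open_nbhs_nbhs; split=> //; move: Ba; rewrite -VB /= muE.
apply; have nuF : range F (F nu) by exists nu.
by apply: (BCR (SigSub (mem_set nuF))); rewrite -VB.
Qed.

(** * Density of the periodic points *)

Lemma periodic_points_iter mu p : (1 <= p)%N -> iter p F mu = mu ->
  periodic_points F mu.
Proof.
move=> p1 pmu.
have ex : exists n, (0 < n)%N && `[< iter n F mu = mu >].
  by exists p; rewrite p1; apply/asboolP.
case: (ex_minnP ex) => q /andP[q1 /asboolP qmu] qmin; exists q; split=> //.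
move=> j /andP[j1 jq] jmu; move: jq; rewrite ltnNge qmin// j1.
exact/asboolP.
Qed.

(** Replace mu inside each cyclic cylinder by a periodic measure carried by that cylinder, keeping
    the weights. Level-m masses are unchanged, and the product of the finitely many return times is
    a period. *)
Lemma supported_closure mu : level_supported mu -> closure (periodic_points F) mu.
Proof.
move=> mu_s U /nbhs_mass[m0 [d [d0 d1 HU]]]; have [m mm fm] := f_levels m0.
pose e (v : m.-tuple bool) := word_point v.
pose cell v := [set x | agree m (e v) x].
have dcell v : determined m (cell v) by exact: determined_agree.
have /choice[q qP] : forall v, exists q : nat, (1 <= q)%N /\
    (level_periodic f m (e v) -> agree m (iter q f (e v)) (e v)).
  move=> v; have [[q q1 vq]|nv] := pselect (level_periodic f m (e v)).
    by exists q.
  by exists 1%N.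
(* For a noncyclic word [q v] is 1 and any F-invariant measure will do, since its weight in the
   average vanishes. *)
have /choice[nu nuP] : forall v, exists nu, iter (q v) F nu = nu /\
    (level_periodic f m (e v) -> mass nu (cell v) = 1).
  move=> v; have [nu nuq nu1] := invariant_measure f_levels (e v) (q v).
  exists nu; split=> // /(proj2 (qP v)) vq; apply: (nu1 m) => //.
  exists (q v) => n j qn.
  have /dvdnP[k ->] : (q v %| n`!)%N by rewrite dvdn_fact// (proj1 (qP v)).
  rewrite mulnC -mulnDr; apply: agree_sym; exact: level_periodicM.
have cells A : determined m A ->
    mass mu A = \sum_v mass mu (cell v) * (e v \in A)%:R.
  exact: mass_sum_words.
have [la la_E] : exists la : cantor_measure R, forall A, clopen_set A ->
    mass la A = \sum_v mass mu (cell v) * mass (nu v) A.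
  apply: bary_exists; first by move=> v; exact: mass_ge0.
  rewrite -(massT mu) (cells setT)//; apply: eq_bigr => v _.
  by rewrite in_setT mulr1.
exists la; split.
  apply: (@periodic_points_iter _ (\prod_v q v)).
    by rewrite prodn_gt0// => v; exact: (proj1 (qP v)).
  apply: (measure_inj f_levels) => k A fk dA.
  rewrite (mass_iter _ _ fk dA) !la_E; last 2 first.
  - by exists k.
  - by exists k; exact: determined_preimage.
  apply: eq_bigr => v _; congr (_ * _); rewrite -(mass_iter _ _ fk dA).
  by rewrite (bigD1 v)//= mulnC iterM iter_fix// (proj1 (nuP v)).
apply: HU mm _ => A dA; rewrite la_E; last by exists m.
suff -> : mass mu A = \sum_v mass mu (cell v) * mass (nu v) A by rewrite lerDl ltW.
rewrite cells//; apply: eq_bigr => v _.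
have [vP|vN] := pselect (level_periodic f m (e v)); last first.
  suff -> : mass mu (cell v) = 0 by rewrite !mul0r.
  apply/eqP; rewrite eq_le mass_ge0 andbT -(mu_s m fm); apply: mass_le.
  - by exists m.
  - by apply: clopen_setC; exists m; exact: determined_level_periodic.
  - move=> x vx xP; apply: vN; apply: determined_level_periodic xP => //.
    exact: agree_sym.
congr (_ * _); have cv1 := proj2 (nuP v) vP.
have cA : clopen_set A by exists m.
have cC : clopen_set (cell v) by exists m.
have [vA|vA] := boolP (e v \in A).
  apply/eqP; rewrite eq_le mass_le1// andbT -cv1 mass_le//.
  by move=> x vx; apply: dA vx _; exact: set_mem.
apply/esym/eqP; rewrite eq_le mass_ge0 andbT.
apply: (@le_trans _ _ (mass (nu v) (~` cell v))); last first.
  by rewrite massC// cv1 subrr.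
apply: mass_le => //; first exact: clopen_setC.
move=> x Ax vx; move/negP: vA; apply; apply: mem_set; apply: dA Ax.
exact: agree_sym.
Qed.

End GenericDynamics.

Theorem theorem16 (R : realType) :
  generic (fun f : cantor_map R =>
    let F := induced_map f in
    [/\ forall p : nat, (1 <= p)%N -> ~ countable (periodic_point F p),
        forall (p : nat) (mu : cantor_measure R), periodic_point F p mu ->
          forall U : set (cantor_measure R), nbhs mu U ->
          forall k : nat, (1 <= k)%N ->
            ~ countable (U `&` periodic_point F (k * p)%N),
        recurrent F = nonwandering F /\ nonwandering F = chain_recurrent F,
        interior (set_val @^-1` chain_recurrent F : set (range F)) = set0 &
        chain_recurrent F `<=` closure (periodic_points F)]).
Proof.
apply: generic_rich => f f_rich F; split.
- exact: periodic_point_uncountable.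
- move=> p mu mup U muU k k1; exact: (periodic_uncountable f_rich mup).
- have cr_r mu : chain_recurrent F mu -> recurrent F mu.
    by move=> /chain_recurrent_supported /(supported_recurrent f_rich).
  have nw_cr mu := @nonwandering_chain_recurrent _ _ f_rich mu.
  split; apply/seteqP; split=> mu.
  + exact: recurrent_nonwandering.
  + by move=> /nw_cr /cr_r.
  + exact: nw_cr.
  + by move=> /cr_r /recurrent_nonwandering.
- exact: chain_recurrent_interior.
- by move=> mu /chain_recurrent_supported /(supported_closure f_rich).
Qed.
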